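(* The logic PLQO is weakly complete: for every PLQO formula $\varphi$, if $\models\varphi$ then $\vdash\varphi$.
   Context: Classical part: propositional symbols $B=\{B_j:j\in\mathbb{N}\}$; classical formulas built from $B$ and $\top$ with $\neg,\to$ ($\wedge,\vee,\leftrightarrow$ abbreviations). $B_\alpha$: symbols occurring in $\alpha$; valuations $v:A\to\{0,1\}$; $\models_c$ classical satisfaction. $B_j\in B_\alpha$ is essential for $\alpha$ if some valuation $v$ on $B_\alpha$ satisfies: $v[B_j\mapsto0]\models_c\alpha$ iff $v[B_j\mapsto1]\not\models_c\alpha$; $eB_\alpha$ is the set of essential symbols of $\alpha$. Quantum structures: for a complex separable Hilbert space $\mathcal{H}$, an observable is a self-adjoint operator with spectral projections $P_S$ ($S$ Borel subset of its spectrum $\Omega$). A pqv is a pair $(O,\uparrow)$, $\uparrow$ a Borel subset of the spectrum, $\downarrow=\Omega\setminus\uparrow$. Two pqvs $(O',\uparrow'),(O'',\uparrow'')$ are compatible if $P'_{\uparrow'}$ and $P''_{\uparrow''}$ commute; a set of pqvs is compatible if every pair in it is. A quantum structure is $I=(\mathcal{H},|\psi\rangle,B_j\mapsto\underline{B}_j)$ with $|\psi\rangle$ a unit vector and $\underline{B}_j=(O_j,\uparrow_j)$ pqvs on $\mathcal{H}$ (spectral projections $P^{(j)}_S$). For $v$ on $A$ and $B_j\in A$, $D^v_{B_j}=\uparrow_j$ if $v(B_j)=1$, else $\downarrow_j$. For $\alpha$ with $B_\alpha=\{B_{j_1},\dots,B_{j_k}\}$, $\mathrm{Prob}_I(\alpha)=\sum_{v:B_\alpha\to\{0,1\},\,v\models_c\alpha}$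 (joint probability that measuring $\underline{B}_{j_1},\dots,\underline{B}_{j_k}$ on $|\psi\rangle$ yields results in $D^v_{B_{j_1}},\dots,D^v_{B_{j_k}}$), the joint probability being $\langle\psi|P^{(j_k)}_{D^v_{B_{j_k}}}\cdots P^{(j_1)}_{D^v_{B_{j_1}}}|\psi\rangle$. $\alpha$ is $I$-observable if $\{\underline{B}_j: B_j\in eB_\alpha\}$ is compatible. Language: terms $p$ are terms of the language of ordered fields (constants $0,1$, $-$, $+$, $\times$) over variables $x_k$, $k\in\mathbb{N}$. PLQO formulas: $\mathsf{O}\alpha$; $\int\alpha\circ p$ ($\circ\in\{=,<\}$); $\varphi_1\to\varphi_2$. $\neg\varphi$ abbreviates $\varphi\to(\int\top<1)$; $\wedge,\vee,\leftrightarrow$ accordingly. Semantics for $I$ and an assignment $\rho$ of reals to variables: $I\rho\models\mathsf{O}\alpha$ iff $\alpha$ is $I$-observable; $I\rho\models\int\alpha\circ p$ iff $\alpha$ is $I$-observable and $\mathrm{Prob}_I(\alpha)\circ p^{\mathbb{R}\rho}$; implication classical. $\models\varphi$ iff $I\rho\models\varphi$ for all $I,\rho$. Calculus: for finite $A\subseteq B$, $U\subseteq A$, $\phi^U_A$ is $(\bigwedge_{B_j\in U}B_j)\wedge(\bigwedge_{B_j\in A\setminus U}\neg B_j)$ ($\top$ if $A=\emptyset$). Extra real variables $x_\alpha$ ($\alpha$ classical) and $x_{A'}$ ($A'\subseteq B$, $|A'|=2$). $Q^A_{\mathsf O}$ is $\bigwedge_{A'\subseteq A,|A'|=2}x_{A'}=0$.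 For finite $A$ and finite $\Delta=\{\alpha_1,\dots,\alpha_n\}$, $Q^{A,\Delta}$ is the conjunction of: $0\le x_{\phi^U_A}\le1$ ($U\subseteq A$); $\sum_{U\subseteq A}x_{\phi^U_A}=1$; $x_{\phi^{U'}_{A'}}=\sum_{U\subseteq A,\,U\cap A'=U'}x_{\phi^U_A}$ ($A'\subseteq A$, $U'\subseteq A'$); $x_{A'}\ge0$ ($A'\subseteq A$, $|A'|=2$); $x_{\alpha_i}=\sum_{v:B_{\alpha_i}\to\{0,1\},\,v\models_c\alpha_i}x_{\phi^{\{B_j\in B_{\alpha_i}:v(B_j)=1\}}_{B_{\alpha_i}}}$ ($i=1,\dots,n$). Translation: $(\mathsf{O}\alpha)^{\mathrm{RCOF}}=Q^{eB_\alpha}_{\mathsf O}$; $(\int\alpha\circ p)^{\mathrm{RCOF}}=Q^{eB_\alpha}_{\mathsf O}\wedge(x_\alpha\circ p)$; $(\varphi_1\to\varphi_2)^{\mathrm{RCOF}}=\varphi_1^{\mathrm{RCOF}}\to\varphi_2^{\mathrm{RCOF}}$. $\varphi_\int$, $\varphi_{\mathsf O}$: sets of formulas of form $\int\alpha\circ p$, resp. $\mathsf{O}\alpha$, occurring in $\varphi$; $B_\varphi$: union of $B_\alpha$ over them. A literal is an atomic PLQO formula or its negation. Axioms and rules: (TT) every PLQO formula that is a propositional tautology (atomic PLQO formulas as atoms); (MP) from $\varphi_1$ and $\varphi_1\to\varphi_2$ infer $\varphi_2$; (RR) $(\beta_1\wedge\dots\wedge\beta_k)\to\beta$ for literals $\beta_1,\dots,\beta_k,\beta$,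 provided the universal closure of $(Q^{B_\varphi,\{\alpha:\int\alpha\circ p\in\varphi_\int\}}\wedge\bigwedge_{j=1}^k\beta_j^{\mathrm{RCOF}})\to\beta^{\mathrm{RCOF}}$ is a theorem of the first-order theory of real closed ordered fields, $\varphi$ being $(\beta_1\wedge\dots\wedge\beta_k)\to\beta$. $\vdash\varphi$ means $\varphi$ is derivable using these axioms and MP. *)

(* Defs.v *)
From HB Require Import structures.
From Stdlib Require List.
From mathcomp Require Import all_boot all_order all_algebra.
From mathcomp Require Import finmap.
From mathcomp.real_closed Require Import complex.
From mathcomp Require Import all_classical all_reals all_analysis.

Set Implicit Arguments.
Unset Strict Implicit.
Unset Printing Implicit Defensive.

Import Order.TTheory GRing.Theory Num.Theory.

Local Open Scope fset_scope.

(* a_1 op ... op a_n associated to the left, and e when the list is empty *)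
Definition seqop (T : Type) (op : T -> T -> T) (e : T) (s : seq T) : T :=
  if s is a :: s' then foldl op a s' else e.

(** * Classical propositional formulas *)

Inductive cform : Type :=
| CTop
| CSym of nat
| CNot of cform
| CImp of cform & cform.

Definition cform_comparable : comparable cform.
Proof. by move=> a b; rewrite /decidable; decide equality; exact: eq_comparable. Defined.

HB.instance Definition _ :=
  hasDecEq.Build cform (compareP cform_comparable).

Definition CAnd (a b : cform) : cform := CNot (CImp a (CNot b)).

Fixpoint csyms (a : cform) : {fset nat} :=
  match a with
  | CTop => fset0
  | CSym j => [fset j]
  | CNot b => csyms b
  | CImp b c => csyms b `|` csyms c
  end.

Fixpoint csat (w : nat -> bool) (a : cform) : bool :=
  match a with
  | CTop => true
  | CSym j => w j
  | CNot b => ~~ csat w b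
  | CImp b c => csat w b ==> csat w c
  end.

(* A valuation on a finite set A of symbols is an element of {ffun A -> bool}.
   It is read as a total function, false outside A; only its values on A are
   ever relevant. *)
Definition vext (A : {fset nat}) (v : {ffun A -> bool}) (j : nat) : bool :=
  if insub j is Some k then v k else false.

Definition vupd (w : nat -> bool) (j : nat) (b : bool) : nat -> bool :=
  fun i => if i == j then b else w i.

Definition essential (a : cform) (j : nat) : bool :=
  [exists v : {ffun csyms a -> bool},
     csat (vupd (vext v) j false) a == ~~ csat (vupd (vext v) j true) a].

Definition esyms (a : cform) : {fset nat} :=
  [fset j in csyms a | essential a j].

(** * Terms of the language of ordered fields *)

Inductive term (X : Type) : Type :=
| TVar of X
| TZero
| TOne
| TOpp of term X
| TAdd of term X & term X
| TMul of term X & term X.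

Arguments TZero {X}.
Arguments TOne {X}.

Fixpoint tbind (X Y : Type) (s : X -> term Y) (t : term X) : term Y :=
  match t with
  | TVar x => s x
  | TZero => TZero
  | TOne => TOne
  | TOpp u => TOpp (tbind s u)
  | TAdd u v => TAdd (tbind s u) (tbind s v)
  | TMul u v => TMul (tbind s u) (tbind s v)
  end.

Definition tmap (X Y : Type) (f : X -> Y) : term X -> term Y :=
  tbind (fun x => TVar (f x)).

Fixpoint tvars (X : Type) (t : term X) : seq X :=
  match t with
  | TVar x => [:: x]
  | TZero | TOne => [::]
  | TOpp u => tvars u
  | TAdd u v | TMul u v => tvars u ++ tvars v
  end.

Fixpoint teval (R : pzRingType) (X : Type) (rho : X -> R) (t : term X) : R :=
  match t with
  | TVar x => rho x
  | TZero => 0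
  | TOne => 1
  | TOpp u => - teval rho u
  | TAdd u v => teval rho u + teval rho v
  | TMul u v => teval rho u * teval rho v
  end%R.

(** * PLQO formulas *)

Variant cmp : Type := CEq | CLt.

Inductive pform : Type :=
| PObs of cform
| PInt of cform & cmp & term nat
| PImp of pform & pform.

Definition PFalse : pform := PInt CTop CLt TOne.
Definition PNot (f : pform) : pform := PImp f PFalse.
Definition PAnd (f g : pform) : pform := PNot (PImp f (PNot g)).

Definition patomic (f : pform) : bool := if f is PImp _ _ then false else true.

Definition pliteral (f : pform) : Prop :=
  patomic f \/ exists2 g, patomic g & f = PNot g.

(** * Quantum structures *)

Section Quantum.
Variable R : realType.
Local Open Scope classical_set_scope.
Local Open Scope ring_scope.
Local Open Scope complex_scope.

(* The inner product is linear in its second argument. *)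
Record preHilbert := PreHilbert {
  hcar :> lmodType R[i];
  ip : hcar -> hcar -> R[i];
  ip_linr : forall x a y z, ip x (a *: y + z) = a * ip x y + ip x z;
  ip_conj : forall x y, ip y x = (ip x y)^*;
  ip_gt0 : forall x, x != 0 -> 0 < ip x x
}.

Definition hnorm (H : preHilbert) (x : H) : R :=
  Num.sqrt (complex.Re (ip x x)).

Definition hcvg (H : preHilbert) (u : nat -> H) (l : H) : Prop :=
  forall e : R, 0 < e -> exists N, forall n, (N <= n)%N -> hnorm (u n - l) < e.

Definition hcauchy (H : preHilbert) (u : nat -> H) : Prop :=
  forall e : R, 0 < e -> exists N, forall m n,
    (N <= m)%N -> (N <= n)%N -> hnorm (u m - u n) < e.

Definition hdense (H : preHilbert) (D : set H) : Prop :=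
  forall (x : H) (e : R), 0 < e -> exists2 y, D y & hnorm (x - y) < e.

Record hilbert := Hilbert {
  hpre :> preHilbert;
  hilbert_complete : forall u : nat -> hpre, hcauchy u -> exists l, hcvg u l;
  hilbert_separable : exists2 D : set hpre, countable D & hdense D
}.

Section Operators.
Variable H : hilbert.

(* Possibly unbounded operators; the values outside the domain are junk. *)
Record operator := Operator {
  odom : set H;
  oval :> H -> H;
  odom0 : odom 0;
  odom_lin : forall a x y, odom x -> odom y -> odom (a *: x + y);
  oval_lin : forall a x y, odom x -> odom y ->
    oval (a *: x + y) = a *: oval x + oval y
}.

(* (y, z) lies in the graph of the adjoint of T *)
Definition adjoint_graph (T : operator) (y z : H) : Prop :=
  forall x, odom T x -> ip (T x) y = ip x z.

Definition self_adjoint (T : operator) : Prop :=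
  hdense (odom T) /\
  forall y z, adjoint_graph T y z <-> (odom T y /\ T y = z).

Definition hbounded (B : H -> H) : Prop :=
  exists c : R, forall x, hnorm (B x) <= c * hnorm x.

(* T - l is a bijection from the domain onto H with a bounded inverse *)
Definition resolvent_set (T : operator) : set R[i] :=
  [set l | exists B : H -> H,
     [/\ hbounded B,
         forall x, odom T (B x) /\ T (B x) - l *: B x = x
       & forall x, odom T x -> B (T x - l *: x) = x]].

Definition spectrum (T : operator) : set R[i] := ~` resolvent_set T.

(* The spectrum of a self-adjoint operator is real. *)
Definition real_spectrum (T : operator) : set R :=
  [set r | spectrum T r%:C].

Definition orth_projection (Q : H -> H) : Prop :=
  [/\ forall a x y, Q (a *: x + y) = a *: Q x + Q y,
      forall x, Q (Q x) = Q x
    & forall x y, ip (Q x) y = ip x (Q y)].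

(* The Borel subsets of R are the measurable sets of measurableTypeR R. *)
Definition pvm (P : set (measurableTypeR R) -> H -> H) : Prop :=
  [/\ forall S, measurable S -> orth_projection (P S),
      forall x, P setT x = x
    & forall (F : nat -> set (measurableTypeR R)),
        (forall n, measurable (F n)) -> trivIset setT F ->
        forall x, hcvg (fun n => \sum_(k < n) P (F k) x) (P (\bigcup_n F n) x)].

Definition vector_measure (P : set (measurableTypeR R) -> H -> H) (x : H) :
    set (measurableTypeR R) -> \bar R :=
  fun S => (complex.Re (ip x (P S x)))%:E.

(* T = \int r dP(r), with its natural domain *)
Definition spectral_measure (T : operator)
    (P : set (measurableTypeR R) -> H -> H) : Prop :=
  [/\ pvm P,
      forall x, odom T x <->
        (\int[vector_measure P x]_r (r ^+ 2)%:E < +oo)%E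
    & forall x, odom T x ->
        (\int[vector_measure P x]_r r%:E = (complex.Re (ip x (T x)))%:E)%E].

(* By the spectral theorem each self-adjoint oop has exactly one oproj on Borel sets,
   so carrying it as a field does not restrict the class of observables. *)
Record observable := Observable {
  oop : operator;
  oop_sa : self_adjoint oop;
  oproj : set (measurableTypeR R) -> H -> H;
  oproj_spectral : spectral_measure oop oproj
}.

Record pqv := Pqv {
  pobs : observable;
  pup : set (measurableTypeR R);
  pup_borel : measurable pup;
  pup_spectrum : pup `<=` real_spectrum (oop pobs)
}.

Definition pdown (b : pqv) : set (measurableTypeR R) :=
  real_spectrum (oop (pobs b)) `\` pup b.

Definition compatible (b c : pqv) : Prop :=
  forall x, oproj (pobs b) (pup b) (oproj (pobs c) (pup c) x) =
            oproj (pobs c) (pup c) (oproj (pobs b) (pup b) x).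

End Operators.

Record qstruct := Qstruct {
  qspace : hilbert;
  qstate : qspace;
  qstate_unit : hnorm qstate = 1;
  qpqv : nat -> pqv qspace
}.

Definition outcome (I : qstruct) (w : nat -> bool) (j : nat) :
    set (measurableTypeR R) :=
  if w j then pup (qpqv I j) else pdown (qpqv I j).

(* <psi| P_{j_k} ... P_{j_1} |psi> for s = [:: j_1; ...; j_k] *)
Definition joint_amplitude (I : qstruct) (w : nat -> bool) (s : seq nat) : R[i] :=
  ip (qstate I)
    (foldl (fun x j => oproj (pobs (qpqv I j)) (outcome I w j) x) (qstate I) s).

(* The symbols are measured in increasing order of their indices. The sum is
   real whenever a is observable, the only case in which it is used. *)
Definition qprob (I : qstruct) (a : cform) : R :=
  complex.Re (\sum_(v : {ffun csyms a -> bool} | csat (vext v) a)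
    joint_amplitude I (vext v) (sort leq (csyms a))).

Definition qobservable (I : qstruct) (a : cform) : Prop :=
  forall i j, i \in esyms a -> j \in esyms a ->
    compatible (qpqv I i) (qpqv I j).

Fixpoint psat (I : qstruct) (rho : nat -> R) (f : pform) : Prop :=
  match f with
  | PObs a => qobservable I a
  | PInt a CEq p => qobservable I a /\ qprob I a = teval rho p
  | PInt a CLt p => qobservable I a /\ qprob I a < teval rho p
  | PImp g h => psat I rho g -> psat I rho h
  end.

Definition plqo_valid (f : pform) : Prop :=
  forall (I : qstruct) (rho : nat -> R), psat I rho f.

End Quantum.

(** * First-order logic of ordered fields *)

(* The variables x_k, x_alpha and x_{A'}; VPair is only used with two-element
   sets. *)
Inductive rvar : Type :=
| VNum of nat
| VForm of cform
| VPair of {fset nat}.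

Definition rvar_comparable : comparable rvar.
Proof. by move=> x y; rewrite /decidable; decide equality; exact: eq_comparable. Defined.

HB.instance Definition _ :=
  hasDecEq.Build rvar (compareP rvar_comparable).

(* Locally nameless syntax: free variables are named (inr), bound variables are
   de Bruijn indices (inl). *)
Definition fterm : Type := term (nat + rvar).

Inductive fo : Type :=
| FEq of fterm & fterm
| FLt of fterm & fterm
| FBot
| FImp of fo & fo
| FAll of fo.

Definition FNot (f : fo) : fo := FImp f FBot.
Definition FTop : fo := FNot FBot.
Definition FAnd (f g : fo) : fo := FNot (FImp f (FNot g)).
Definition FOr (f g : fo) : fo := FImp (FNot f) g.
Definition FLe (s t : fterm) : fo := FOr (FLt s t) (FEq s t).
Definition fconj : seq fo -> fo := seqop FAnd FTop.

Definition fvar (x : rvar) : fterm := TVar (inr x).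
Definition fterm_of (t : term rvar) : fterm := tmap inr t.

Fixpoint ffree (f : fo) : seq rvar :=
  match f with
  | FEq s t | FLt s t =>
      pmap (fun v => if v is inr x then Some x else None) (tvars s ++ tvars t)
  | FBot => [::]
  | FImp g h => ffree g ++ ffree h
  | FAll g => ffree g
  end.

(* Replace the dangling index k by t; t has no bound variable, hence no
   shifting is needed. *)
Definition topen (k : nat) (t : term rvar) : fterm -> fterm :=
  tbind (fun v => if v == inl k then fterm_of t else TVar v).

Fixpoint fopen (k : nat) (t : term rvar) (f : fo) : fo :=
  match f with
  | FEq s u => FEq (topen k t s) (topen k t u)
  | FLt s u => FLt (topen k t s) (topen k t u)
  | FBot => FBot
  | FImp g h => FImp (fopen k t g) (fopen k t h)
  | FAll g => FAll (fopen k.+1 t g)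
  end.

Definition tclose (k : nat) (x : rvar) : fterm -> fterm :=
  tmap (fun v => if v == inr x then inl k else v).

Fixpoint fclose (k : nat) (x : rvar) (f : fo) : fo :=
  match f with
  | FEq s u => FEq (tclose k x s) (tclose k x u)
  | FLt s u => FLt (tclose k x s) (tclose k x u)
  | FBot => FBot
  | FImp g h => FImp (fclose k x g) (fclose k x h)
  | FAll g => FAll (fclose k.+1 x g)
  end.

Definition fforall (x : rvar) (f : fo) : fo := FAll (fclose 0 x f).
Definition fexists (x : rvar) (f : fo) : fo := FNot (fforall x (FNot f)).

Definition fo_closure (f : fo) : fo := foldr fforall f (undup (ffree f)).

(* Classical natural deduction with equality. *)
Inductive nd : seq fo -> fo -> Prop :=
| nd_hyp G f : List.In f G -> nd G f
| nd_weak G D f : (forall g, List.In g G -> List.In g D) -> nd G f -> nd D f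
| nd_impI G f g : nd (f :: G) g -> nd G (FImp f g)
| nd_impE G f g : nd G (FImp f g) -> nd G f -> nd G g
| nd_raa G f : nd (FNot f :: G) FBot -> nd G f
| nd_allI G f x :
    x \notin ffree f -> (forall g, List.In g G -> x \notin ffree g) ->
    nd G (fopen 0 (TVar x) f) -> nd G (FAll f)
| nd_allE G f t : nd G (FAll f) -> nd G (fopen 0 t f)
| nd_eqI G t : nd G (FEq (fterm_of t) (fterm_of t))
| nd_eqE G f s t :
    nd G (FEq (fterm_of s) (fterm_of t)) -> nd G (fopen 0 s f) ->
    nd G (fopen 0 t f).

(** * The theory of real closed ordered fields *)

Local Notation X k := (fvar (VNum k)) (only parsing).
Local Notation x := (X 0) (only parsing).
Local Notation y := (X 1) (only parsing).
Local Notation z := (X 2) (only parsing).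

(* X 0 + X 1 * t + ... + X n * t ^ n *)
Definition generic_poly (n : nat) (t : fterm) : fterm :=
  foldr (fun k u => TAdd (X k) (TMul t u)) TZero (iota 0 n.+1).

(* Real closedness is the intermediate value property for polynomials, as in
   the interface rcfType; here for the polynomial with coefficients
   X 0, ..., X n. *)
Definition poly_ivt_axiom (n : nat) : fo :=
  let a := X n.+1 in let b := X n.+2 in let c := X n.+3 in
  fo_closure
    (FImp (FAnd (FLe a b)
            (FAnd (FLe (generic_poly n a) TZero) (FLe TZero (generic_poly n b))))
       (fexists (VNum n.+3)
         (FAnd (FAnd (FLe a c) (FLe c b)) (FEq (generic_poly n c) TZero)))).

Inductive rcof_axiom : fo -> Prop :=
| rcof_addA : rcof_axiom (fo_closure (FEq (TAdd x (TAdd y z)) (TAdd (TAdd x y) z)))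
| rcof_addC : rcof_axiom (fo_closure (FEq (TAdd x y) (TAdd y x)))
| rcof_add0 : rcof_axiom (fo_closure (FEq (TAdd x TZero) x))
| rcof_addN : rcof_axiom (fo_closure (FEq (TAdd x (TOpp x)) TZero))
| rcof_mulA : rcof_axiom (fo_closure (FEq (TMul x (TMul y z)) (TMul (TMul x y) z)))
| rcof_mulC : rcof_axiom (fo_closure (FEq (TMul x y) (TMul y x)))
| rcof_mul1 : rcof_axiom (fo_closure (FEq (TMul x TOne) x))
| rcof_mulD : rcof_axiom
    (fo_closure (FEq (TMul x (TAdd y z)) (TAdd (TMul x y) (TMul x z))))
| rcof_neq01 : rcof_axiom (FNot (FEq TZero TOne))
| rcof_mulV : rcof_axiom
    (fo_closure (FImp (FNot (FEq x TZero)) (fexists (VNum 1) (FEq (TMul x y) TOne))))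
| rcof_ltxx : rcof_axiom (fo_closure (FNot (FLt x x)))
| rcof_lt_trans : rcof_axiom
    (fo_closure (FImp (FAnd (FLt x y) (FLt y z)) (FLt x z)))
| rcof_lt_total : rcof_axiom (fo_closure (FOr (FLt x y) (FOr (FEq x y) (FLt y x))))
| rcof_ltD : rcof_axiom
    (fo_closure (FImp (FLt x y) (FLt (TAdd x z) (TAdd y z))))
| rcof_ltM : rcof_axiom
    (fo_closure (FImp (FAnd (FLt TZero x) (FLt TZero y)) (FLt TZero (TMul x y))))
| rcof_poly_ivt n : rcof_axiom (poly_ivt_axiom n).

Definition rcof_theorem (f : fo) : Prop :=
  exists2 G : seq fo, (forall g, List.In g G -> rcof_axiom g) & nd G f.

(** * The calculus *)

(* The conjunction of the symbols in U and the negations of those in A \ U *)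
Definition cphi (A U : {fset nat}) : cform :=
  if A == fset0 then CTop else
  CAnd (seqop CAnd CTop [seq CSym j | j <- sort leq U])
       (seqop CAnd CTop [seq CNot (CSym j) | j <- sort leq (A `\` U)]).

Definition xform (a : cform) : fterm := fvar (VForm a).
Definition xpair (A : {fset nat}) : fterm := fvar (VPair A).

Definition fsum : seq fterm -> fterm := seqop (@TAdd _) TZero.

Definition fsubsets (A : {fset nat}) : seq {fset nat} := enum_fset (fpowerset A).
Definition fpairs (A : {fset nat}) : seq {fset nat} :=
  [seq A' <- fsubsets A | #|` A'| == 2].

Definition QO (A : {fset nat}) : fo :=
  fconj [seq FEq (xpair A') TZero | A' <- fpairs A].

Definition vtrue (A : {fset nat}) (v : {ffun A -> bool}) : {fset nat} :=
  [fset j in A | vext v j].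

Definition QAD (A : {fset nat}) (Delta : seq cform) : fo :=
  fconj (
    [seq FAnd (FLe TZero (xform (cphi A U))) (FLe (xform (cphi A U)) TOne)
       | U <- fsubsets A]
    ++ [:: FEq (fsum [seq xform (cphi A U) | U <- fsubsets A]) TOne]
    ++ [seq FEq (xform (cphi A' U'))
           (fsum [seq xform (cphi A U) | U <- fsubsets A & U `&` A' == U'])
         | A' <- fsubsets A, U' <- fsubsets A']
    ++ [seq FLe TZero (xpair A') | A' <- fpairs A]
    ++ [seq FEq (xform a)
           (fsum [seq xform (cphi (csyms a) (vtrue v))
                   | v : {ffun csyms a -> bool} <- enum {: {ffun csyms a -> bool}}
                   & csat (vext v) a])
         | a <- Delta]).

Definition fcmp (c : cmp) : fterm -> fterm -> fo :=
  match c with CEq => FEq | CLt => FLt end.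

Fixpoint rcof (f : pform) : fo :=
  match f with
  | PObs a => QO (esyms a)
  | PInt a c p =>
      FAnd (QO (esyms a))
        (fcmp c (xform a) (tmap (fun k => inr (VNum k)) p))
  | PImp g h => FImp (rcof g) (rcof h)
  end.

(* The formulas a such that some \int a o p occurs in f *)
Fixpoint pints (f : pform) : seq cform :=
  match f with
  | PObs _ => [::]
  | PInt a _ _ => [:: a]
  | PImp g h => pints g ++ pints h
  end.

Fixpoint psyms (f : pform) : {fset nat} :=
  match f with
  | PObs a | PInt a _ _ => csyms a
  | PImp g h => psyms g `|` psyms h
  end.

Fixpoint peval (w : pform -> bool) (f : pform) : bool :=
  if f is PImp g h then peval w g ==> peval w h else w f.

Definition ptautology (f : pform) : Prop := forall w, peval w f.

(* b_1 /\ ... /\ b_k -> b, for b1 :: bs = [:: b_1; ...; b_k] *)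
Definition rr_formula (b1 : pform) (bs : seq pform) (b : pform) : pform :=
  PImp (foldl PAnd b1 bs) b.

Definition rr_proviso (b1 : pform) (bs : seq pform) (b : pform) : Prop :=
  let f := rr_formula b1 bs b in
  rcof_theorem (fo_closure
    (FImp (FAnd (QAD (psyms f) (undup (pints f))) (fconj (map rcof (b1 :: bs))))
          (rcof b))).

Inductive plqo_derivable : pform -> Prop :=
| TT f : ptautology f -> plqo_derivable f
| MP f g : plqo_derivable f -> plqo_derivable (PImp f g) -> plqo_derivable g
| RR b1 bs b :
    (forall c, List.In c (b1 :: bs) -> pliteral c) -> pliteral b ->
    rr_proviso b1 bs b -> plqo_derivable (rr_formula b1 bs b).

(* Main.v *)
(** By propositional reasoning it suffices to derive, for each assignment of
    truth values to the atoms of a valid formula that would falsify it, that the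
    corresponding conjunction of literals implies falsity; this is an instance of
    RR once the translated statement is a theorem of RCOF.

    A universal sentence true in one real closed field is a theorem of RCOF: a
    Henkin construction turns unprovability into a real closed field where it
    fails, and a failing point is moved to any other real closed field one
    variable at a time. The latter is the Cohen-Hormander argument: in a finite
    family of polynomials closed under derivative, pseudo-remainder and
    truncation, the signs of the leading coefficients determine which sign
    vectors the family takes; Thom's lemma recovers the order of the points from
    their sign vectors.

    Conversely a real solution of the translation yields a quantum structure:
    take the classical distribution of the x_{phi^U_A} on the subsets of A, with
    diagonal projections, and add for each pair with x_{A'} <> 0 a block C^2, not
    seen by the state, on which the two projections fail to commute. *)
Require Import Defs.
From HB Require Import structures.
From Stdlib Require List.
From mathcomp Require Import all_boot all_order all_algebra.
From mathcomp Require Import finmap.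
From mathcomp.real_closed Require Import complex polyorder polyrcf.
From mathcomp Require Import all_classical all_reals all_analysis.
From mathcomp Require Import measurable_realfun.
From mathcomp Require Import lra ring.

Set Implicit Arguments.
Unset Strict Implicit.
Unset Printing Implicit Defensive.

Import Order.TTheory GRing.Theory Num.Theory.
Import numFieldNormedType.Exports.

(** * Transfer of sign conditions between real closed fields *)

(** RR asks for provability from the axioms, whereas a PLQO model only ever yields real points. A
    Henkin model is an arbitrary real closed field, so a failing point found there has to be carried
    to the reals. Only the existence of a point with given signs is carried, and only for formulas
    without quantifiers: a morphism from an iterated polynomial ring over the integers plays the
    part of a point, and the induction ends at the integers, whose signs no ordered field can
    change.

    Falsity is not a connective but the atom [PFalse]. A propositional valuation may make it true,
    so ex falso is not a tautology and has to come from RR, where [QAD] forces the variable of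
    [CTop] to be 1.

    On the quantum side the variables of pairs are unrelated to one another and to the distribution,
    so commutation must be switched on or off for each pair separately without changing a single
    probability. Blocks orthogonal to the state, one for each pair, achieve this. *)

Section SignTransfer.
Local Open Scope ring_scope.

(** The operation strictly lowers the size, so closing from the largest sizes downwards stops. Stage
    [k] is closed for arguments of size at least [N - k]; what the next stage really adds lies below
    its own threshold [N - k.+1], hence is never among the arguments concerned. *)
Lemma finite_closure (T : eqType) (sz : T -> nat) (op : T -> T -> seq T)
    (P : seq T) :
  (forall p q r, r \in op p q -> (sz r < minn (sz p) (sz q))%N) ->
  exists2 C : seq T, {subset P <= C} &
    {in C &, forall p q, {subset op p q <= C}}.
Proof.
move=> op_lt; pose N := (\max_(p <- P) sz p).+1.
suff H k : (k <= N)%N -> exists2 C : seq T, {subset P <= C} &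
    (forall p, p \in C -> (sz p < N)%N) /\
    {in C &, forall p q, (N - k <= minn (sz p) (sz q))%N ->
      {subset op p q <= C}}.
  have [C PC [_ HC]] := H N (leqnn N); exists C => // p q pC qC.
  by apply: HC => //; rewrite subnn.
elim: k => [|k IH] kN.
  exists P => //; split=> [p pP|p q pP qP]; first by rewrite ltnS leq_bigmax_seq.
  rewrite subn0 leq_min => /andP[+ _].
  by rewrite leqNgt ltnS leq_bigmax_seq.
have [C PC [CN HC]] := IH (ltnW kN).
have kE : (N - k = (N - k.+1).+1)%N by rewrite subnSK.
exists (C ++ [seq r | p <- C, r <- flatten (map (op p) C)]).
  by move=> p pP; rewrite mem_cat PC.
have new r : r \in [seq r | p <- C, r <- flatten (map (op p) C)] ->
    r \in C \/ (sz r < N - k.+1)%N.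
  case/allpairsPdep=> p [r' [pC /flatten_mapP[q qC r'op] ->]].
  have := op_lt _ _ _ r'op; set m := minn _ _ => r'm.
  have [Nm|mN] := leqP (N - k)%N m; first by left; apply: HC r'op.
  by right; apply: leq_trans r'm _; rewrite -ltnS -kE.
split=> [p|p q].
  rewrite mem_cat => /orP[/CN //|/new[/CN //|/leq_trans]]; apply.
  exact: leq_subr.
have old r : r \in C ++ [seq r | p <- C, r <- flatten (map (op p) C)] ->
    (N - k.+1 <= sz r)%N -> r \in C.
  by rewrite mem_cat => /orP[//|/new[//|]]; rewrite ltnNge => /negP.
move=> /old pC /old qC; rewrite leq_min => /andP[/pC {}pC /qC {}qC] r rop.
rewrite mem_cat; apply/orP; right.
by apply/allpairsPdep; exists p, r; split=> //; apply/flatten_mapP; exists q.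
Qed.

Section Sgz.
Variable F : realDomainType.
Implicit Types a b c : F.

Lemma ler_sgz a b : a <= b -> sgz a <= sgz b.
Proof. by case: (sgzP a); case: (sgzP b) => //= *; exfalso; lra. Qed.

Lemma sgz_sandwich a b c : a <= b -> b <= c -> sgz a = sgz c -> sgz b = sgz a.
Proof.
move=> /ler_sgz ab /ler_sgz bc ac; apply/eqP.
by rewrite eq_le ab andbT ac.
Qed.

End Sgz.

(** * Signs of a polynomial on an interval *)

Section Rcf.
Variable F : rcfType.
Implicit Types (r : {poly F}) (x y z a b : F).

Lemma sgz_horner_itv r (i : interval F) x y :
  {in i, forall z, ~~ root r z} -> x \in i -> y \in i -> sgz r.[x] = sgz r.[y].
Proof.
by move=> /polyrN0_itv H xi yi; rewrite -sgz_sgr (H y) // sgz_sgr.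
Qed.

(** By induction the derivative has a constant sign on the interval, so [r] is monotone there and
    its sign is squeezed between two equal end signs. *)
Lemma thom_const r x y z :
  (forall n, sgz r^`(n).[x] = sgz r^`(n).[y]) ->
  z \in `[x, y] -> sgz r.[z] = sgz r.[x].
Proof.
have [n] := ubnP (size r); elim: n r z => // n IH r z /ltnSE sr H zxy.
have [r0|r0] := eqVneq r 0; first by rewrite r0 !horner0.
have {}IH w : w \in `[x, y] -> sgz r^`().[w] = sgz r^`().[x].
  move=> wxy; apply: IH => //; first exact: leq_trans (lt_size_deriv r0) sr.
  by move=> m; rewrite -!derivSn.
have xxy : x \in `[x, y] by rewrite in_itv /= lexx (itvP zxy).
have yxy : y \in `[x, y] by rewrite in_itv /= lexx (itvP zxy).
have [d0|d0] := lerP 0 r^`().[x].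
  have mono := @ler_hornerW F x y r.
  apply: (@sgz_sandwich _ _ _ r.[y]) (H 0%N); apply: mono => //;
    rewrite ?(itvP zxy) // => w /subset_itv_oo_cc /IH;
    by rewrite -[_ <= _]sgz_ge0 => ->; rewrite sgz_ge0.
have mono := @ler_hornerW F x y (- r).
apply: oppr_inj; rewrite -!sgzN -!hornerN.
have HN : sgz (- r).[x] = sgz (- r).[y] by rewrite !hornerN !sgzN [sgz r.[x]](H 0%N).
apply: (@sgz_sandwich _ _ _ (- r).[y]) HN; apply: mono => //;
    rewrite ?(itvP zxy) // => w /subset_itv_oo_cc /IH;
    by rewrite derivN hornerN oppr_ge0 -[_ <= _]sgz_le0 => ->; rewrite sgz_le0 ltW.
Qed.

Lemma zero_on_itv r x y : x < y -> {in `[x, y], forall z, root r z} -> r = 0.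
Proof.
move=> xy H; apply/eqP/negPn/negP => r0.
have [z zn] := neighpr_wit xy r0.
have /negP[] := neighpr_root zn; apply: H.
have := next_root_in r x y; rewrite max_l ?ltW // => h.
by rewrite in_itv /= !ltW ?(itvP zn) // (lt_le_trans _ (_ : next_root r x y <= y)) ?(itvP zn) ?(itvP h).
Qed.

Lemma sgz_near r a e : 0 < e -> r.[a] != 0 ->
  exists2 d, 0 < d < e & forall y, `|y - a| <= d -> sgz r.[y] = sgz r.[a].
Proof.
move=> e0 ra; have [|d d0 H] := @poly_cont F a r `|r.[a]|; first by rewrite normr_gt0.
exists (Num.min d e / 2).
  have : 0 < Num.min d e by rewrite lt_min d0.
  have : Num.min d e <= e by rewrite ge_min lexx orbT.
  by move=> *; apply/andP; split; lra.
move=> y ya; have /H : `|y - a| < d.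
  apply: le_lt_trans ya _.
  have : 0 < Num.min d e by rewrite lt_min d0.
  have : Num.min d e <= d by rewrite ge_min lexx.
  lra.
have [a0|a0|/eqP a0] := ltrgtP r.[a] 0; last by rewrite a0 in ra.
  rewrite (ltr0_sgz a0) (ltr0_norm a0) ltr_norml => /andP[? ?].
  by apply: ltr0_sgz; lra.
rewrite (gtr0_sgz a0) (gtr0_norm a0) ltr_norml => /andP[? ?].
by apply: gtr0_sgz; lra.
Qed.

(** The mean value theorem on either side of [x] yields two slopes, which have the same sign because
    the derivative has no root in between. *)
Lemma strictly_between r a x b : a < x -> x < b ->
  {in `]a, b[, forall z, ~~ root r^`() z} ->
  r.[a] < r.[x] < r.[b] \/ r.[b] < r.[x] < r.[a].
Proof.
move=> ax xb H.
have [c cax Ec] := poly_mvt r ax; have [d dxb Ed] := poly_mvt r xb.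
have cab : c \in `]a, b[ by rewrite in_itv /= (itvP cax) (lt_trans _ xb) ?(itvP cax).
have dab : d \in `]a, b[ by rewrite in_itv /= (itvP dxb) (lt_trans ax) ?(itvP dxb).
have := sgz_horner_itv H cab dab; have := H c cab; rewrite rootE.
have ax0 : 0 < x - a by lra. have xb0 : 0 < b - x by lra.
case: sgzP => // c0 _ /esym/eqP; rewrite sgz_cp0 => d0; [left|right].
  have : 0 < r^`().[c] * (x - a) by rewrite mulr_gt0.
  have : 0 < r^`().[d] * (b - x) by rewrite mulr_gt0.
  by rewrite -Ec -Ed => *; apply/andP; split; lra.
have : r^`().[c] * (x - a) < 0 by rewrite nmulr_rlt0.
have : r^`().[d] * (b - x) < 0 by rewrite nmulr_rlt0.
by rewrite -Ec -Ed => *; apply/andP; split; lra.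
Qed.

End Rcf.

(** If [r] vanishes at [x], the end values have opposite signs and the intermediate value theorem in
    [F'] gives a root. Otherwise the value at [x] lies strictly between the end values and shares
    the sign of one of them, and this sign persists near the matching end point of [F']. *)
Lemma sign_between (F F' : rcfType) (r : {poly F}) (r' : {poly F'})
    (a x b : F) (a' b' : F') :
  a < x -> x < b -> a' < b' -> {in `]a, b[, forall z, ~~ root r^`() z} ->
  sgz r.[a] = sgz r'.[a'] -> sgz r.[b] = sgz r'.[b'] ->
  exists2 x', a' < x' < b' & sgz r.[x] = sgz r'.[x'].
Proof.
move=> ax xb ab' H Ha Hb; have := strictly_between ax xb H.
have ab0 : 0 < b' - a' by lra.
case: (eqVneq r.[x] 0) => [x0|x0] B.
  have [] := @poly_ivtoo F' r' a' b'; first exact: ltW.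
    rewrite -sgz_lt0 sgzM -Ha -Hb -sgzM sgz_lt0.
    by case: B; rewrite x0 => /andP[? ?]; [rewrite nmulr_rlt0|rewrite pmulr_rlt0].
  move=> y yab /rootP y0; exists y; first by rewrite !(itvP yab).
  by rewrite x0 y0 !sgz0.
have [E|E] : sgz r.[x] = sgz r.[a] \/ sgz r.[x] = sgz r.[b].
- have [c|c|c] := sgzP r.[x]; first by rewrite c eqxx in x0.
    by case: B => /andP[? ?]; [right|left]; rewrite gtr0_sgz //; lra.
  by case: B => /andP[? ?]; [left|right]; rewrite ltr0_sgz //; lra.
- have a0 : r'.[a'] != 0 by rewrite -sgz_eq0 -Ha -E sgz_eq0.
  have [d /andP[d0 de] Hd] := sgz_near ab0 a0.
  exists (a' + d); first by apply/andP; split; lra.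
  by rewrite E Ha Hd // addrAC subrr add0r gtr0_norm.
- have b0 : r'.[b'] != 0 by rewrite -sgz_eq0 -Hb -E sgz_eq0.
  have [d /andP[d0 de] Hd] := sgz_near ab0 b0.
  exists (b' - d); first by apply/andP; split; lra.
  by rewrite E Hb Hd // addrAC subrr add0r normrN gtr0_norm.
Qed.

(** * Points of two fields with the same sign vector *)

Section Agreement.
Variable S : comNzRingType.
Implicit Types (D : seq {poly S}) (p q : {poly S}).

(** This is [q] without its leading term; it has the same image as [q] in a field where the leading
    coefficient of [q] becomes 0. *)
Definition poly_trunc q : {poly S} := take_poly (size q).-1 q.

Definition deriv_closed D := {in D, forall q, q != 0 -> q^`() \in D}.
Definition trunc_closed D := {in D, forall q, q != 0 -> poly_trunc q \in D}.
Definition rem_closed p D :=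
  {in D, forall q, q != 0 -> Pdiv.Ring.rmodp p q \in D}.

Lemma size_poly_trunc q : q != 0 -> (size (poly_trunc q) < size q)%N.
Proof.
by rewrite -size_poly_gt0 => q0; rewrite (leq_ltn_trans (size_take_poly _ _)) ?prednK.
Qed.

Lemma map_poly_trunc (F : nzRingType) (f : {rmorphism S -> F}) q :
  f (lead_coef q) = 0 -> map_poly f (poly_trunc q) = map_poly f q.
Proof.
move=> f0; apply/polyP=> i; rewrite !coef_map /= coef_take_poly.
case: ltnP => // qi; have [<-|qi'] := eqVneq (size q).-1 i.
  by rewrite -lead_coefE f0 rmorph0.
rewrite nth_default //; move: qi qi'; case: (size q) => //= n.
by rewrite leq_eqVlt => /predU1P[->|//]; rewrite eqxx.
Qed.

Section TwoFields.
Variables (F F' : rcfType).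
Variables (f : {rmorphism S -> F}) (f' : {rmorphism S -> F'}).

Definition agree D (x : F) (x' : F') :=
  {in D, forall q, sgz (map_poly f q).[x] = sgz (map_poly f' q).[x']}.

Definition lead_agree D :=
  {in D, forall q, sgz (f (lead_coef q)) = sgz (f' (lead_coef q))}.

Lemma lead_agree_eq0 D q : lead_agree D -> q \in D ->
  (f' (lead_coef q) == 0) = (f (lead_coef q) == 0).
Proof. by move=> lD qD; rewrite -sgz_eq0 -lD // sgz_eq0. Qed.

(** By [lead_agree] a leading coefficient vanishes in both fields at once, and truncation then
    changes neither image. Repeating it ends at a polynomial whose degree survives in both
    fields. *)
Lemma lead_representative D q : trunc_closed D -> lead_agree D ->
  q \in D -> map_poly f q != 0 ->
  exists q1, [/\ q1 \in D, f (lead_coef q1) != 0, (size q1 <= size q)%N,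
    map_poly f q1 = map_poly f q & map_poly f' q1 = map_poly f' q].
Proof.
move=> tD lD; have [n] := ubnP (size q); elim: n q => // n IH q /ltnSE sq qD fq.
have [lq|lq] := eqVneq (f (lead_coef q)) 0; last by exists q.
have q0 : q != 0 by apply: contraNneq fq => ->; rewrite rmorph0.
have /eqP lq' : f' (lead_coef q) == 0 by rewrite (lead_agree_eq0 lD) ?lq.
have st := size_poly_trunc q0.
have [||//|q1 [q1D lq1 sq1 Eq1 Eq1']] := IH (poly_trunc q).
- exact: leq_trans st sq.
- exact: tD.
- by rewrite map_poly_trunc.
exists q1; split=> //; first exact: leq_trans sq1 (ltnW st).
  by rewrite Eq1 map_poly_trunc.
by rewrite Eq1' map_poly_trunc.
Qed.

Lemma agree_map_neq0 D q : trunc_closed D -> lead_agree D ->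
  q \in D -> map_poly f q != 0 -> map_poly f' q != 0.
Proof.
move=> tD lD qD fq; have [q1 [q1D lq1 _ Eq1 <-]] := lead_representative tD lD qD fq.
rewrite -size_poly_eq0 size_map_poly_id0 ?(lead_agree_eq0 lD) // size_poly_eq0.
by apply: contraNneq lq1 => ->; rewrite lead_coef0 rmorph0.
Qed.

(** At a root of [q], pseudo-division equates [p], times a power of a leading coefficient, with the
    remainder. That power has the same nonzero sign in both fields, so the sign of the remainder
    decides that of [p]. *)
Lemma agree_rem D p q x x' : trunc_closed D -> lead_agree D -> rem_closed p D ->
  agree D x x' -> q \in D -> map_poly f q != 0 -> root (map_poly f q) x ->
  sgz (map_poly f p).[x] = sgz (map_poly f' p).[x'].
Proof.
move=> tD lD rD A qD fq qx.
have [q1 [q1D lq1 _ Eq1 Eq1']] := lead_representative tD lD qD fq.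
have q1x : (map_poly f q1).[x] = 0 by rewrite Eq1; apply/rootP.
have q1x' : (map_poly f' q1).[x'] = 0.
  by apply/eqP; rewrite -sgz_eq0 -A // sgz_eq0 q1x.
have q10 : q1 != 0 by apply: contraNneq lq1 => ->; rewrite lead_coef0 rmorph0.
have E := Pdiv.ComRing.rdivp_eq q1 p; set k := Pdiv.Ring.rscalp _ _ in E.
have Ef : f (lead_coef q1) ^+ k * (map_poly f p).[x] =
          (map_poly f (Pdiv.Ring.rmodp p q1)).[x].
  have := congr1 (fun u => (map_poly f u).[x]) E.
  by rewrite /= rmorphD rmorphM /= map_polyZ hornerD hornerM hornerZ q1x
    mulr0 add0r rmorphXn.
have Ef' : f' (lead_coef q1) ^+ k * (map_poly f' p).[x'] =
          (map_poly f' (Pdiv.Ring.rmodp p q1)).[x'].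
  have := congr1 (fun u => (map_poly f' u).[x']) E.
  by rewrite /= rmorphD rmorphM /= map_polyZ hornerD hornerM hornerZ q1x'
    mulr0 add0r rmorphXn.
have := A _ (rD _ q1D q10); rewrite -Ef -Ef' !sgzM !sgzX -lD // => /mulfI; apply.
by rewrite expf_neq0 // sgz_eq0.
Qed.

End TwoFields.

Lemma agree_sym (F F' : rcfType) (f : {rmorphism S -> F})
    (f' : {rmorphism S -> F'}) D x x' : agree f f' D x x' -> agree f' f D x' x.
Proof. by move=> A q /A ->. Qed.

Lemma lead_agree_sym (F F' : rcfType) (f : {rmorphism S -> F})
    (f' : {rmorphism S -> F'}) D : lead_agree f f' D -> lead_agree f' f D.
Proof. by move=> A q /A ->. Qed.

Lemma derivn_in D q n : deriv_closed D -> q \in D -> q^`(n) \in D \/ q^`(n) = 0.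
Proof.
move=> dD qD; elim: n => [|n IH]; first by left.
rewrite derivnS; case: IH => [h|->]; last by right; rewrite deriv0.
have [->|q0] := eqVneq q^`(n) 0; first by right; rewrite deriv0.
by left; apply: dD.
Qed.

Lemma derivn_map_sgz (F : rcfType) (f : {rmorphism S -> F}) D q x y :
  deriv_closed D -> q \in D ->
  {in D, forall q', (size q' <= size q)%N ->
     sgz (map_poly f q').[x] = sgz (map_poly f q').[y]} ->
  forall n, sgz (map_poly f q)^`(n).[x] = sgz (map_poly f q)^`(n).[y].
Proof.
move=> dD qD H n; rewrite derivn_map.
case: (derivn_in n dD qD) => [|->]; last by rewrite rmorph0 !horner0.
move=> /H; apply; elim: n => // n; rewrite derivnS => IH.
have [->|q0] := eqVneq q^`(n) 0; first by rewrite deriv0 size_poly0.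
exact: leq_trans (ltnW (lt_size_deriv q0)) IH.
Qed.

(* By Thom's lemma a derivative-closed family of signs locates a root. *)
Lemma thom_inj (F : rcfType) (f : {rmorphism S -> F}) D q x y :
  deriv_closed D -> q \in D -> map_poly f q != 0 -> root (map_poly f q) x ->
  {in D, forall q', sgz (map_poly f q').[x] = sgz (map_poly f q').[y]} ->
  x = y.
Proof.
move=> dD qD fq qx H.
have qy : root (map_poly f q) y by rewrite rootE -sgz_eq0 -H // sgz_eq0.
have {}H n : sgz (map_poly f q)^`(n).[x] = sgz (map_poly f q)^`(n).[y].
  by apply: (derivn_map_sgz dD qD) => q' /H.
wlog xy : x y qx qy H / x < y => [W|].
  by have [/W|/W W'|] := ltrgtP x y => //; [apply|apply: esym; apply: W'].
(* The polynomial is 0 at both ends and the signs of all derivatives agree, so [thom_const] makes it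
   vanish on the whole interval. *)
case/negP: fq; apply/eqP; apply: (zero_on_itv xy) => z zxy.
by rewrite rootE -sgz_eq0 (thom_const H zxy) sgz_eq0.
Qed.

Lemma monotone_thom (F : rcfType) (r : {poly F}) x y : x <= y ->
  (forall n, sgz r^`(n.+1).[x] = sgz r^`(n.+1).[y]) ->
  (0 <= sgz r^`().[x] -> r.[x] <= r.[y]) /\ (sgz r^`().[x] <= 0 -> r.[y] <= r.[x]).
Proof.
move=> xy H.
have C z : z \in `[x, y] -> sgz r^`().[z] = sgz r^`().[x].
  by move=> zxy; apply: thom_const zxy => n; rewrite -!derivSn.
have xxy : x \in `[x, y] by rewrite in_itv /= lexx.
have yxy : y \in `[x, y] by rewrite in_itv /= lexx xy.
split=> s0.
  apply: (@ler_hornerW F x y) => // w /subset_itv_oo_cc /C.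
  by rewrite -[0 <= r^`().[w]]sgz_ge0 => ->.
rewrite -lerN2 -!hornerN; apply: (@ler_hornerW F x y) => // w /subset_itv_oo_cc /C.
by rewrite derivN hornerN oppr_ge0 -[r^`().[w] <= 0]sgz_le0 => ->.
Qed.

(** Take [q] of least size separating the two points. The signs of its derivatives agree at both, so
    [q] is monotone between them, in both fields and in the same direction. A reversed order in [F']
    would then force the two signs of [q] to coincide. *)
Lemma thom_order (F F' : rcfType) (f : {rmorphism S -> F})
    (f' : {rmorphism S -> F'}) D q x y x' y' :
  deriv_closed D -> agree f f' D x x' -> agree f f' D y y' -> q \in D ->
  sgz (map_poly f q).[x] != sgz (map_poly f q).[y] -> x < y -> x' < y'.
Proof.
move=> dD Ax Ay; have [n] := ubnP (size q); elim: n q => // n IH q /ltnSE sq qD nq xy.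
have [/hasP[q1 q1D /andP[sq1 nq1]]|/hasPn H] :=
  boolP (has (fun q1 => (size q1 < size q)%N &&
     (sgz (map_poly f q1).[x] != sgz (map_poly f q1).[y])) D).
  by apply: (IH q1) => //; apply: leq_trans sq1 sq.
have q0 : q != 0 by apply: contraNneq nq => ->; rewrite rmorph0 !horner0.
have q'D : q^`() \in D by apply: dD.
have {}H : {in D, forall q1, (size q1 <= size q^`())%N ->
     sgz (map_poly f q1).[x] = sgz (map_poly f q1).[y]}.
  move=> q1 /H; rewrite negb_and negbK => /orP[|/eqP //]; rewrite -leqNgt => s1 s2.
  by have := leq_ltn_trans (leq_trans s1 s2) (lt_size_deriv q0); rewrite ltnn.
have H' : {in D, forall q1, (size q1 <= size q^`())%N ->
     sgz (map_poly f' q1).[y'] = sgz (map_poly f' q1).[x']}.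
  by move=> q1 q1D s1; rewrite -Ax // -Ay // H.
have Hn m : sgz (map_poly f q)^`(m.+1).[x] = sgz (map_poly f q)^`(m.+1).[y].
  by rewrite derivSn deriv_map; apply: (derivn_map_sgz dD q'D H).
have Hn' m : sgz (map_poly f' q)^`(m.+1).[y'] = sgz (map_poly f' q)^`(m.+1).[x'].
  by rewrite derivSn deriv_map; apply: (derivn_map_sgz dD q'D H').
rewrite ltNge; apply: contraNN nq => yx'.
have [up dn] := monotone_thom (ltW xy) Hn; have [up' dn'] := monotone_thom yx' Hn'.
have Ed : sgz (map_poly f' q)^`().[y'] = sgz (map_poly f q)^`().[x].
  by rewrite !deriv_map -Ay // H.
rewrite Ed in up' dn'; rewrite eq_le {2}Ax // {1}Ay // {1}Ax // {1}Ay //.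
have [s0|/ltW s0] := lerP 0 (sgz (map_poly f q)^`().[x]).
  by rewrite (ler_sgz (up' s0)) -Ax // -Ay // (ler_sgz (up s0)).
by rewrite -Ax // -Ay // (ler_sgz (dn s0)) Ax // Ay // (ler_sgz (dn' s0)).
Qed.

End Agreement.

(** * Extending agreement by one polynomial *)

Section Extension.
Variable S : comNzRingType.

Section NonzeroProduct.
Variables (F : rcfType) (f : {rmorphism S -> F}) (D : seq {poly S}).

(** The roots cut the line into cells on which every member of [D] has a constant sign. Images that
    vanish identically are left out, as they would turn the product into 0. *)
Definition nzprod : {poly F} :=
  \prod_(q <- D | map_poly f q != 0) map_poly f q.

Lemma nzprod_neq0 : nzprod != 0.
Proof. by rewrite prodf_seq_neq0; apply/allP => q _; apply/implyP. Qed.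

Lemma root_nzprod x :
  reflect (exists q, [/\ q \in D, map_poly f q != 0 & root (map_poly f q) x])
          (root nzprod x).
Proof.
rewrite /root horner_prod prodf_seq_eq0; apply: (iffP hasP) => [[q qD /andP[]]|[q []]].
  by exists q.
by exists q => //; apply/andP.
Qed.

End NonzeroProduct.

Variables (F F' : rcfType).
Variables (f : {rmorphism S -> F}) (f' : {rmorphism S -> F'}).
Variables (D : seq {poly S}) (p : {poly S}).
Hypothesis dD : deriv_closed D.
Hypothesis tD : trunc_closed D.
Hypothesis rD : rem_closed p D.
Hypothesis lD : lead_agree f f' D.
Hypothesis lp : sgz (f (lead_coef p)) = sgz (f' (lead_coef p)).
Hypothesis fp : f (lead_coef p) != 0.
Hypothesis fwd : forall x, exists x', agree f f' D x x'.
Hypothesis bwd : forall x', exists x, agree f f' D x x'.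

Let fp' : f' (lead_coef p) != 0.
Proof. by rewrite -sgz_eq0 -lp sgz_eq0. Qed.

Let root_agree x x' : agree f f' D x x' ->
  root (nzprod f D) x = root (nzprod f' D) x'.
Proof.
move=> A; apply/root_nzprod/root_nzprod => -[q [qD fq qx]]; exists q; split=> //.
- exact: agree_map_neq0 tD lD _ fq.
- by rewrite rootE -sgz_eq0 -A // sgz_eq0.
- exact: agree_map_neq0 tD (lead_agree_sym lD) _ fq.
- by rewrite rootE -sgz_eq0 A // sgz_eq0.
Qed.

(** Some member of [D] vanishes at the root [x] and not at [y], so [thom_order] applies in both
    directions. *)
Let order_agree x x' y y' : agree f f' D x x' -> agree f f' D y y' ->
  root (nzprod f D) x -> ~~ root (nzprod f D) y -> (x' < y') = (x < y).
Proof.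
move=> Ax Ay /root_nzprod[q [qD fq qx]] ny.
have nq : sgz (map_poly f q).[x] != sgz (map_poly f q).[y].
  rewrite (rootP qx) sgz0 eq_sym sgz_eq0; apply: contraNneq ny => qy.
  by apply/root_nzprod; exists q; split=> //; apply/rootP.
apply/idP/idP; last exact: (thom_order dD Ax Ay qD nq).
move=> xy'; apply: (thom_order dD (agree_sym Ax) (agree_sym Ay) qD) xy'.
by rewrite -Ax // -Ay.
Qed.

(** Here [y] may be a root as well. If no member of [D] separates the points, [thom_inj] in [F']
    makes them equal, against [x' < y']. *)
Let order_agree_root x x' y y' : agree f f' D x x' -> agree f f' D y y' ->
  root (nzprod f D) x -> x' < y' -> x < y.
Proof.
move=> Ax Ay rx xy.
have [/hasP[q qD nq]|/hasPn H] := boolP (has (fun q =>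
    sgz (map_poly f' q).[x'] != sgz (map_poly f' q).[y']) D).
  exact: (thom_order dD (agree_sym Ax) (agree_sym Ay) qD nq).
have [q [qD fq qx]] := root_nzprod f' D x' (etrans (esym (root_agree Ax)) rx).
have E : x' = y' by apply: thom_inj dD qD fq qx _ => q' /H; rewrite negbK => /eqP.
by rewrite E ltxx in xy.
Qed.

Let rem_agree x x' : agree f f' D x x' -> root (nzprod f D) x ->
  sgz (map_poly f p).[x] = sgz (map_poly f' p).[x'].
Proof. by move=> A /root_nzprod[q [qD fq qx]]; apply: agree_rem tD lD rD A qD fq qx. Qed.

Let mp0 : map_poly f p != 0.
Proof.
rewrite -size_poly_eq0 size_map_poly_id0 // size_poly_eq0.
by apply: contraNneq fp => ->; rewrite lead_coef0 rmorph0.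
Qed.

Let mp0' : map_poly f' p != 0.
Proof.
rewrite -size_poly_eq0 size_map_poly_id0 // size_poly_eq0.
by apply: contraNneq fp' => ->; rewrite lead_coef0 rmorph0.
Qed.

(** The end point is the last root of [nzprod] before [x], where a remainder fixes the sign of [p];
    if there is none, it is a point so far left that [p] has its sign at minus infinity. A root
    inside the matching interval of [F'] would, by [bwd] and the preservation of order, have a
    counterpart between [a] and [x]. *)
Lemma left_endpoints x x' : agree f f' D x x' -> ~~ root (nzprod f D) x ->
  exists a a', [/\ a < x, a' < x',
    {in `]a, x[, forall z, ~~ root (nzprod f D) z},
    {in `]a', x'[, forall z, ~~ root (nzprod f' D) z} &
    sgz (map_poly f p).[a] = sgz (map_poly f' p).[a']].
Proof.
move=> A nx.
pose W := nzprod f D * map_poly f p; pose W' := nzprod f' D * map_poly f' p.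
have W0 : W != 0 by rewrite mulf_neq0 ?nzprod_neq0.
have W0' : W' != 0 by rewrite mulf_neq0 ?nzprod_neq0.
(* The Cauchy bound is that of the product with [p], so that neither [nzprod] nor [p] has a root up
   to [a0]; the term [x - 1] keeps [a0] strictly below [x]. *)
pose a0 := Num.min (x - 1) (- cauchy_bound W).
pose a0' := Num.min (x' - 1) (- cauchy_bound W').
have a0x : a0 < x by rewrite gt_min; apply/orP; left; lra.
have a0x' : a0' < x' by rewrite gt_min; apply/orP; left; lra.
have := @prev_noroot F (nzprod f D) a0 x; have := prev_root_lt a0x (nzprod_neq0 f D).
case: prev_rootP => [E|a _ a_root a_in _|a _ a_min _]; first by rewrite E ltxx.
  move=> ax noroot_ax; have ra : root (nzprod f D) a by apply/rootP.
  have [a' Aa] := fwd a; exists a, a'; split=> //.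
  - by rewrite (order_agree Aa A).
  - move=> z' z'in; apply/negP => rz'; have [z Az] := bwd z'.
    have rz : root (nzprod f D) z by rewrite (root_agree Az).
    have zx : z < x by rewrite -(order_agree Az A) // (itvP z'in).
    have az : a < z by apply: (order_agree_root Aa Az) => //; rewrite (itvP z'in).
    by have := noroot_ax z; rewrite in_itv /= az zx rz => /(_ isT).
  - exact: rem_agree.
rewrite min_l ?ltW // in a_min; rewrite {}a_min => _ noroot_ax.
have low z : z <= a0 -> ~~ root W z.
  move=> za; apply: (le_cauchy_bound W0); rewrite in_itv /=.
  by apply: le_trans za _; rewrite ge_min lexx orbT.
have low' z : z <= a0' -> ~~ root W' z.
  move=> za; apply: (le_cauchy_bound W0'); rewrite in_itv /=.
  by apply: le_trans za _; rewrite ge_min lexx orbT.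
exists a0, a0'; split=> //.
  move=> z' z'in; apply/negP => rz'; have [z Az] := bwd z'.
  have rz : root (nzprod f D) z by rewrite (root_agree Az).
  have zx : z < x by rewrite -(order_agree Az A) // (itvP z'in).
  have [/low|az] := lerP z a0; first by rewrite rootM rz.
  by have := noroot_ax z; rewrite in_itv /= az zx rz => /(_ isT).
have s1 : sgz (map_poly f p).[a0] = sgz (sgp_minfty (map_poly f p)).
  rewrite -(@sgp_minftyP _ a0 _ _ a0) ?sgz_sgr ?in_itv //= => z.
  by rewrite in_itv /= => /low; rewrite rootM negb_or => /andP[].
have s2 : sgz (map_poly f' p).[a0'] = sgz (sgp_minfty (map_poly f' p)).
  rewrite -(@sgp_minftyP _ a0' _ _ a0') ?sgz_sgr ?in_itv //= => z.
  by rewrite in_itv /= => /low'; rewrite rootM negb_or => /andP[].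
(* The leading coefficient of [p] survives in both fields, so the degrees, and with them the parity
   in the sign at minus infinity, are equal. *)
rewrite s1 s2 /sgp_minfty !sgz_sgr !sgzM !sgzX !sgzN1 !size_map_poly_id0 //.
by rewrite !lead_coef_map_id0 ?rmorph0 // lp.
Qed.

Lemma right_endpoints x x' : agree f f' D x x' -> ~~ root (nzprod f D) x ->
  exists b b', [/\ x < b, x' < b',
    {in `]x, b[, forall z, ~~ root (nzprod f D) z},
    {in `]x', b'[, forall z, ~~ root (nzprod f' D) z} &
    sgz (map_poly f p).[b] = sgz (map_poly f' p).[b']].
Proof.
move=> A nx.
(* [order_agree] compares a root with a non-root to its right, so the comparison is negated here. *)
have order z z' : agree f f' D z z' -> root (nzprod f D) z -> (x' < z') = (x < z).
  move=> Az rz; have nxz : x != z by apply: contraNneq nx => ->.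
  have nxz' : x' != z'.
    by apply: contraNneq nx => E; rewrite (root_agree A) E -(root_agree Az).
  by rewrite !ltNge !le_eqVlt ![_ == x]eq_sym ![_ == x']eq_sym (negPf nxz) (negPf nxz')
    /= (order_agree Az A).
pose W := nzprod f D * map_poly f p; pose W' := nzprod f' D * map_poly f' p.
have W0 : W != 0 by rewrite mulf_neq0 ?nzprod_neq0.
have W0' : W' != 0 by rewrite mulf_neq0 ?nzprod_neq0.
pose b0 := Num.max (x + 1) (cauchy_bound W).
pose b0' := Num.max (x' + 1) (cauchy_bound W').
have b0x : x < b0 by rewrite lt_max; apply/orP; left; lra.
have b0x' : x' < b0' by rewrite lt_max; apply/orP; left; lra.
have := @next_noroot F (nzprod f D) x b0; have := next_root_gt b0x (nzprod_neq0 f D).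
case: next_rootP => [E|b _ b_root b_in _|b _ b_max _]; first by rewrite E ltxx.
  move=> xb noroot_xb; have rb : root (nzprod f D) b by apply/rootP.
  have [b' Ab] := fwd b; exists b, b'; split=> //.
  - by rewrite (order _ _ Ab).
  - move=> z' z'in; apply/negP => rz'; have [z Az] := bwd z'.
    have rz : root (nzprod f D) z by rewrite (root_agree Az).
    have xz : x < z by rewrite -(order _ _ Az) // (itvP z'in).
    have zb : z < b by apply: (order_agree_root Az Ab) => //; rewrite (itvP z'in).
    by have := noroot_xb z; rewrite in_itv /= zb xz rz => /(_ isT).
  - exact: rem_agree.
rewrite max_l ?ltW // in b_max; rewrite {}b_max => _ noroot_xb.
have high z : b0 <= z -> ~~ root W z.
  move=> za; apply: (ge_cauchy_bound W0); rewrite in_itv /= andbT.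
  by apply: le_trans za; rewrite le_max lexx orbT.
have high' z : b0' <= z -> ~~ root W' z.
  move=> za; apply: (ge_cauchy_bound W0'); rewrite in_itv /= andbT.
  by apply: le_trans za; rewrite le_max lexx orbT.
exists b0, b0'; split=> //.
  move=> z' z'in; apply/negP => rz'; have [z Az] := bwd z'.
  have rz : root (nzprod f D) z by rewrite (root_agree Az).
  have xz : x < z by rewrite -(order _ _ Az) // (itvP z'in).
  have [/high|zb] := lerP b0 z; first by rewrite rootM rz.
  by have := noroot_xb z; rewrite in_itv /= zb xz rz => /(_ isT).
have s1 : sgz (map_poly f p).[b0] = sgz (sgp_pinfty (map_poly f p)).
  rewrite -(@sgp_pinftyP _ b0 _ _ b0) ?sgz_sgr ?in_itv ?andbT //= => z.
  by rewrite in_itv /= andbT => /high; rewrite rootM negb_or => /andP[].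
have s2 : sgz (map_poly f' p).[b0'] = sgz (sgp_pinfty (map_poly f' p)).
  rewrite -(@sgp_pinftyP _ b0' _ _ b0') ?sgz_sgr ?in_itv ?andbT //= => z.
  by rewrite in_itv /= andbT => /high'; rewrite rootM negb_or => /andP[].
rewrite s1 s2 /sgp_pinfty !sgz_sgr.
by rewrite !lead_coef_map_id0 ?rmorph0 // lp.
Qed.

Hypothesis pD : p^`() \in D.

(** At a root of [nzprod] a remainder decides. Elsewhere [x] lies in an open cell matched with a
    cell of [F']; the derivative of [p] belongs to [D] and has no root in the cell, so
    [sign_between] finds the required sign of [p] in the matching cell, throughout which the signs
    of [D] are constant. *)
Lemma agree_extend x : exists x', agree f f' (p :: D) x x'.
Proof.
have [x' A] := fwd x.
suff [x'' pA A'] : exists2 x'', sgz (map_poly f p).[x] = sgz (map_poly f' p).[x'']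
    & agree f f' D x x''.
  by exists x'' => q; rewrite inE => /predU1P[-> //|]; apply: A'.
have [rx|nx] := boolP (root (nzprod f D) x).
  by exists x' => //; apply: rem_agree.
(* A constant [p] has derivative 0, which [nzprod] ignores; its sign is that of its leading
   coefficient. *)
have [sp|sp] := leqP (size p) 1.
  have pE := size1_polyC sp; exists x' => //.
  have lE : lead_coef p = p`_0 by rewrite [in LHS]pE lead_coefC.
  by rewrite pE !map_polyC /= !hornerC -lE.
have [a [a' [ax ax' na na' pa]]] := left_endpoints A nx.
have [b [b' [xb xb' nb nb' pb]]] := right_endpoints A nx.
have nx' : ~~ root (nzprod f' D) x' by rewrite -(root_agree A).
have nab : {in `]a, b[, forall z, ~~ root (nzprod f D) z}.
  move=> z zab; have [zx|xz|->//] := ltrgtP z x.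
    by apply: na; rewrite in_itv /= zx (itvP zab).
  by apply: nb; rewrite in_itv /= xz (itvP zab).
have nab' : {in `]a', b'[, forall z, ~~ root (nzprod f' D) z}.
  move=> z zab; have [zx|xz|->//] := ltrgtP z x'.
    by apply: na'; rewrite in_itv /= zx (itvP zab).
  by apply: nb'; rewrite in_itv /= xz (itvP zab).
have dp0 : (map_poly f p)^`() != 0.
  rewrite -size_poly_eq0 size_deriv size_map_poly_id0 //.
  by case: (size p) sp => [|[]].
have ndp : {in `]a, b[, forall z, ~~ root (map_poly f p)^`() z}.
  move=> z /nab; apply: contraNN => rz; apply/root_nzprod.
  by exists p^`(); rewrite -deriv_map.
have [x'' /andP[ax'' xb''] px''] := sign_between ax xb (lt_trans ax' xb') ndp pa pb.
exists x'' => // q qD; rewrite A //.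
have [fq|fq] := eqVneq (map_poly f' q) 0; first by rewrite fq !horner0.
apply: (@sgz_horner_itv _ _ `]a', b'[); rewrite ?in_itv /= ?ax' ?xb' ?ax'' //.
by move=> z /nab'; apply: contraNN => rz; apply/root_nzprod; exists q.
Qed.

End Extension.

(** One variable is eliminated: [L] consists of the leading coefficients of a closed family. Its
    members enter the agreement by increasing size, and one at a time within a size, each time
    through [agree_extend]. *)
Lemma sign_projection (S : comNzRingType) (P : seq {poly S}) :
  exists L : seq S, forall (F F' : rcfType) (f : {rmorphism S -> F})
    (f' : {rmorphism S -> F'}), {in L, forall s, sgz (f s) = sgz (f' s)} ->
  forall x, exists x', agree f f' P x x'.
Proof.
(* The size filter makes [finite_closure] applicable and keeps all that is needed: derivatives and
   truncations are taken at [q = p], and remainders only by divisors that are not larger than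
   [p]. *)
pose op (p q : {poly S}) := [seq r : {poly S} <- [:: p^`(); poly_trunc p; Pdiv.Ring.rmodp p q]
  | (size r < minn (size p) (size q))%N].
have [|C PC HC] := @finite_closure {poly S} (fun p => size p) op P.
  by move=> p q r; rewrite mem_filter => /andP[].
have derC q : q \in C -> q != 0 -> q^`() \in C.
  move=> qC q0; apply: (HC q q) => //.
  by rewrite mem_filter minnn lt_size_deriv // inE eqxx.
have truncC q : q \in C -> q != 0 -> poly_trunc q \in C.
  move=> qC q0; apply: (HC q q) => //.
  by rewrite mem_filter minnn size_poly_trunc // !inE eqxx orbT.
have remC p q : p \in C -> q \in C -> q != 0 -> (size q <= size p)%N ->
    Pdiv.Ring.rmodp p q \in C.
  move=> pC qC q0 qp; apply: (HC p q) => //; rewrite mem_filter.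
  by rewrite (minn_idPr qp) Pdiv.Ring.ltn_rmodp q0 !inE eqxx !orbT.
exists (map lead_coef C); pose Cd d := [seq p : {poly S} <- C | (size p <= d)%N].
(* The claim ranges over all pairs of fields, because the backward hypothesis of [agree_extend] is
   the same claim with the fields exchanged. *)
suff H d (F F' : rcfType) (f : {rmorphism S -> F}) (f' : {rmorphism S -> F'}) :
    lead_agree f f' C -> forall x, exists x', agree f f' (Cd d) x x'.
  move=> F F' f f' lC x.
  have [x' A] : exists x', agree f f' (Cd (\max_(p <- P) size p)) x x'.
    by apply: H => p pC; apply: lC; apply: map_f.
  exists x' => p pP; apply: A.
  by rewrite mem_filter PC // andbT (@leq_bigmax_seq _ P xpredT (fun p => size p)).
elim: d F F' f f' => [|d IHd] F F' f f' lC x.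
  exists 0 => p; rewrite mem_filter leqn0 size_poly_eq0 => /andP[/eqP -> _].
  by rewrite !rmorph0 !horner0 !sgz0.
suff H E (F1 F2 : rcfType) (f1 : {rmorphism S -> F1}) (f2 : {rmorphism S -> F2}) :
    lead_agree f1 f2 C -> {in E, forall p, p \in C /\ size p = d.+1} ->
    forall x, exists x', agree f1 f2 (E ++ Cd d) x x'.
  have [x' A] : exists x', agree f f' ([seq p : {poly S} <- C | size p == d.+1] ++ Cd d) x x'.
    by apply: H => // p; rewrite mem_filter => /andP[/eqP].
  exists x' => p; rewrite mem_filter leq_eqVlt => /andP[/orP[sp|sp] pC]; apply: A;
    by rewrite mem_cat !mem_filter pC ?sp // orbC -ltnS sp.
elim: E F1 F2 f1 f2 => [|p E IHE] F1 F2 f1 f2 {}lC HE {}x; first exact: IHd.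
have [pC sp] : p \in C /\ size p = d.+1 by apply: HE; rewrite mem_head.
have {}HE : {in E, forall q, q \in C /\ size q = d.+1}.
  by move=> q qE; apply: HE; rewrite inE qE orbT.
have p0 : p != 0 by rewrite -size_poly_eq0 sp.
have inCd q : q \in C -> (size q < d.+1)%N -> q \in E ++ Cd d.
  by move=> qC sq; rewrite mem_cat mem_filter qC -ltnS sq orbT.
have inD q : q \in E ++ Cd d -> q \in C /\ (size q <= d.+1)%N.
  rewrite mem_cat mem_filter => /orP[/HE[-> ->] //|/andP[/leqW -> ->]] //.
(* A vanishing leading coefficient lets [p] be replaced by its truncation, which is smaller and
   already covered. *)
have [lp|lp] := eqVneq (f1 (lead_coef p)) 0.
  have [x' A] := IHE _ _ _ _ lC HE x; exists x' => q.
  rewrite inE => /predU1P[->|/A //].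
  have /eqP lp' : f2 (lead_coef p) == 0 by rewrite (lead_agree_eq0 lC) ?lp.
  rewrite -(map_poly_trunc lp) -(map_poly_trunc lp'); apply: A.
  by apply: inCd; [apply: truncC|rewrite -sp size_poly_trunc].
apply: agree_extend => //.
- move=> q /inD[qC sq] q0; apply: inCd; first exact: derC.
  exact: leq_trans (lt_size_deriv q0) sq.
- move=> q /inD[qC sq] q0; apply: inCd; first exact: truncC.
  exact: leq_trans (size_poly_trunc q0) sq.
- move=> q /inD[qC sq] q0; apply: inCd; first by apply: remC; rewrite ?sp.
  by apply: leq_trans sq; rewrite Pdiv.Ring.ltn_rmodp.
- by move=> q /inD[/lC].
- exact: lC.
- exact: IHE.
- move=> x'; have [y A] := IHE _ _ _ _ (lead_agree_sym lC) HE x'.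
  by exists y; apply: agree_sym.
- by apply: inCd; [apply: derC|rewrite -sp lt_size_deriv].
Qed.

(** Integer polynomials in [n] variables, one layer per variable so that the outermost can be
    eliminated. A morphism into a field is a point with [n] coordinates in it. *)
Fixpoint iter_poly (n : nat) : comNzRingType :=
  if n is n'.+1 then {poly iter_poly n'} else int.

Fixpoint iter_var (n i : nat) : iter_poly n :=
  if n is n'.+1 then
    if i == n' then 'X else (iter_var n' i)%:P
  else 0.

Lemma iter_eval (F : rcfType) (n : nat) (e : nat -> F) :
  exists f : {rmorphism iter_poly n -> F},
    forall i, (i < n)%N -> f (iter_var n i) = e i.
Proof.
elim: n => [|n [f Hf]]; first by exists intr.
pose cf := fun c : iter_poly n => mulrC (e n) (f c).
exists (horner_morph cf) => i; rewrite ltnS leq_eqVlt /=.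
case: eqVneq => [-> _|ni /= lt_in]; first by rewrite horner_morphX.
by rewrite horner_morphC Hf.
Qed.

(** The list [L] from [sign_projection] is passed to the induction hypothesis, after which the
    outermost coordinate can be chosen in [F']. *)
Lemma sign_transfer (F F' : rcfType) (n : nat) (f : {rmorphism iter_poly n -> F})
    (P : seq (iter_poly n)) :
  exists f' : {rmorphism iter_poly n -> F'},
    {in P, forall p, sgz (f p) = sgz (f' p)}.
Proof.
elim: n f P => [|n IH] f P.
  exists intr => p _; have -> : f p = p%:~R by rewrite -[p in LHS]intz rmorph_int.
  by rewrite !sgz_int.
pose f0 : {rmorphism iter_poly n -> F} := f \o polyC.
have [L HL] := sign_projection P; have [f0' Hf0'] := IH f0 L.
have [x' A] := HL _ _ f0 f0' Hf0' (f 'X).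
pose cf := fun c : iter_poly n => mulrC x' (f0' c).
exists (horner_morph cf) => p pP; rewrite (poly_initial f) /=.
exact: A.
Qed.

(** * Structures for the language of ordered fields *)

Section Semantics.

(** No axiom is imposed, since the Henkin model has to be such a structure before anything is known
    about its operations. *)
Record ostruct := OStruct {
  ocar :> Type;
  ozero : ocar;
  oone : ocar;
  oopp : ocar -> ocar;
  oadd : ocar -> ocar -> ocar;
  omul : ocar -> ocar -> ocar;
  olt : ocar -> ocar -> Prop
}.

Fixpoint otval (M : ostruct) (X : Type) (e : X -> M) (t : term X) : M :=
  match t with
  | TVar x => e x
  | TZero => ozero M
  | TOne => oone M
  | TOpp u => oopp (otval e u)
  | TAdd u v => oadd (otval e u) (otval e v)
  | TMul u v => omul (otval e u) (otval e v)
  end.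

Definition oenv (M : Type) (b : nat -> M) (rho : rvar -> M) (v : nat + rvar) : M :=
  match v with inl k => b k | inr x => rho x end.

Definition opush (M : Type) (m : M) (b : nat -> M) (k : nat) : M :=
  if k is k'.+1 then b k' else m.

Fixpoint osat (M : ostruct) (b : nat -> M) (rho : rvar -> M) (f : fo) : Prop :=
  match f with
  | FEq s t => otval (oenv b rho) s = otval (oenv b rho) t
  | FLt s t => olt (otval (oenv b rho) s) (otval (oenv b rho) t)
  | FBot => False
  | FImp g h => osat b rho g -> osat b rho h
  | FAll g => forall m, osat (opush m b) rho g
  end.

Definition ring_ostruct (F : numDomainType) : ostruct :=
  @OStruct F 0 1 -%R +%R *%R (fun x y => x < y).

Lemma otval_ring (F : numDomainType) (X : Type) (e : X -> F) (t : term X) :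
  @otval (ring_ostruct F) X e t = teval e t.
Proof. by elim: t => //= [u ->|u -> v ->|u -> v ->]. Qed.

Fixpoint fqf (f : fo) : bool :=
  match f with
  | FImp g h => fqf g && fqf h
  | FAll _ => false
  | _ => true
  end.

Fixpoint fatoms (f : fo) : seq (fterm * fterm) :=
  match f with
  | FEq s t | FLt s t => [:: (s, t)]
  | FImp g h => fatoms g ++ fatoms h
  | _ => [::]
  end.

Lemma rmorph_teval (A B : pzRingType) (h : {rmorphism A -> B}) (X : Type)
    (e : X -> A) (t : term X) : h (teval e t) = teval (h \o e) t.
Proof.
elim: t => //= [||u <-|u <- v <-|u <- v <-]; rewrite ?rmorph0 ?rmorph1 //.
- by rewrite rmorphN.
- by rewrite rmorphD.
- by rewrite rmorphM.
Qed.

Lemma eq_in_teval (A : pzRingType) (X : eqType) (e e' : X -> A) (t : term X) :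
  {in tvars t, e =1 e'} -> teval e t = teval e' t.
Proof.
elim: t => //= [x H|u IH /IH -> //|u IHu v IHv H|u IHu v IHv H].
- by rewrite H ?mem_head.
- by rewrite IHu ?IHv // => x xv; apply: H; rewrite mem_cat xv ?orbT.
- by rewrite IHu ?IHv // => x xv; apply: H; rewrite mem_cat xv ?orbT.
Qed.

Lemma sgz_eq_transfer (F F' : realDomainType) (a b : F) (a' b' : F') :
  sgz (a - b) = sgz (a' - b') -> (a = b <-> a' = b') /\ (a < b <-> a' < b').
Proof.
move=> E; split; last by rewrite -subr_lt0 -sgz_lt0 E sgz_lt0 subr_lt0.
split=> /eqP; rewrite -subr_eq0 -sgz_eq0; [rewrite E|rewrite -E];
  by rewrite sgz_eq0 subr_eq0 => /eqP.
Qed.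

(** An atom depends only on the sign of the difference of its sides, which is an integer polynomial
    in the variables that occur, dangling indices included. *)
Theorem qf_transfer (F F' : rcfType) (g : fo) (b : nat -> F) (rho : rvar -> F) :
  fqf g -> exists b' rho',
    @osat (ring_ostruct F) b rho g <-> @osat (ring_ostruct F') b' rho' g.
Proof.
move=> qg.
pose tv := fun st : fterm * fterm => tvars st.1 ++ tvars st.2.
pose vs := flatten (map tv (fatoms g)).
pose n := size vs; pose sigma v := iter_var n (index v vs).
pose df := fun st : fterm * fterm => teval sigma st.1 - teval sigma st.2.
have [f Hf] := @iter_eval F n (fun i => oenv b rho (nth (inl 0%N) vs i)).
have [f' Hf'] := @sign_transfer F F' n f
  (map df (fatoms g)).
exists (fun k => f' (sigma (inl k))), (fun x => f' (sigma (inr x))).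
set b' := (fun k => _); set rho' := (fun x => _).
have E' t : @otval (ring_ostruct F') _ (oenv b' rho') t = f' (teval sigma t).
  by rewrite otval_ring rmorph_teval; apply: eq_in_teval => -[].
have E t : {subset tvars t <= vs} ->
    @otval (ring_ostruct F) _ (oenv b rho) t = f (teval sigma t).
  move=> tvs; rewrite otval_ring rmorph_teval; apply: eq_in_teval => v /tvs vvs /=.
  by rewrite Hf ?index_mem // nth_index.
have atom s t : {subset tv (s, t) <= vs} -> df (s, t) \in map df (fatoms g) ->
    sgz (@otval (ring_ostruct F) _ (oenv b rho) s -
         @otval (ring_ostruct F) _ (oenv b rho) t : F) =
    sgz (@otval (ring_ostruct F') _ (oenv b' rho') s -
         @otval (ring_ostruct F') _ (oenv b' rho') t : F').
  move=> sub st; rewrite !E; first by rewrite !E' -!rmorphB; apply: Hf'.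
    by move=> v vt; apply: sub; rewrite mem_cat vt orbT.
  by move=> v vt; apply: sub; rewrite mem_cat vt.
suff H h : fqf h -> {subset flatten (map tv (fatoms h)) <= vs} ->
    {subset map df (fatoms h) <= map df (fatoms g)} ->
    @osat (ring_ostruct F) b rho h <-> @osat (ring_ostruct F') b' rho' h.
  exact: H.
elim: h => //= [s t _ sub subd|s t _ sub subd|h1 IH1 h2 IH2 /andP[q1 q2]].
- apply: (sgz_eq_transfer _).1; apply: atom; last by apply: subd; rewrite mem_head.
  by move=> v vst; apply: sub; rewrite cats0.
- apply: (sgz_eq_transfer _).2; apply: atom; last by apply: subd; rewrite mem_head.
  by move=> v vst; apply: sub; rewrite cats0.
rewrite !map_cat flatten_cat => sub subd.
have H1 : @osat (ring_ostruct F) b rho h1 <-> @osat (ring_ostruct F') b' rho' h1.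
  by apply: IH1 => // v vh; [apply: sub|apply: subd]; rewrite mem_cat vh.
have H2 : @osat (ring_ostruct F) b rho h2 <-> @osat (ring_ostruct F') b' rho' h2.
  by apply: IH2 => // v vh; [apply: sub|apply: subd]; rewrite mem_cat vh orbT.
tauto.
Qed.

End Semantics.

End SignTransfer.

(** * Completeness of RCOF for universal sentences *)

(** Local closure at depth [k]. Raw syntax allows dangling indices, and closing followed by opening
    restores only formulas without index [k] or above. *)
Definition vlc (k : nat) (v : nat + rvar) : bool :=
  if v is inl i then i < k else true.

Definition tlc (k : nat) (t : fterm) : bool := all (vlc k) (tvars t).

Fixpoint flc (k : nat) (f : fo) : bool :=
  match f with
  | FEq s t | FLt s t => tlc k s && tlc k t
  | FBot => true
  | FImp g h => flc k g && flc k h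
  | FAll g => flc k.+1 g
  end.

Lemma tvars_tbind (X Y : Type) (s : X -> term Y) t :
  tvars (tbind s t) = flatten [seq tvars (s x) | x <- tvars t].
Proof.
by elim: t => //= [x|u -> v ->|u -> v ->]; rewrite ?cats0 // map_cat flatten_cat.
Qed.

Lemma tvars_tmap (X Y : Type) (g : X -> Y) t : tvars (tmap g t) = map g (tvars t).
Proof. by rewrite tvars_tbind; elim: (tvars t) => //= x s ->. Qed.

Lemma tbind_comp (X Y Z : Type) (s : X -> term Y) (s' : Y -> term Z) t :
  tbind s' (tbind s t) = tbind (tbind s' \o s) t.
Proof. by elim: t => //= [u ->|u -> v ->|u -> v ->]. Qed.

Lemma eq_in_tbind (X : eqType) (Y : Type) (s s' : X -> term Y) t :
  {in tvars t, s =1 s'} -> tbind s t = tbind s' t.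
Proof.
elim: t => //= [x H|u IH /IH -> //|u IHu v IHv H|u IHu v IHv H].
- by rewrite H ?mem_head.
- by rewrite IHu ?IHv // => x xv; apply: H; rewrite mem_cat xv ?orbT.
- by rewrite IHu ?IHv // => x xv; apply: H; rewrite mem_cat xv ?orbT.
Qed.

Lemma tbind_var (X : Type) (t : term X) : tbind (@TVar X) t = t.
Proof. by elim: t => //= [u ->|u -> v ->|u -> v ->]. Qed.

Lemma topen_tclose k x t : tlc k t -> topen k (TVar x) (tclose k x t) = t.
Proof.
move=> /allP lct; rewrite /topen /tclose /tmap tbind_comp -[RHS]tbind_var.
apply: eq_in_tbind => v /lct /=; case: (eqVneq v (inr x)) => [->|nv].
  by rewrite eqxx.
by case: eqVneq => [->|//] /=; rewrite ltnn.
Qed.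

Lemma fopen_fclose k x f : flc k f -> fopen k (TVar x) (fclose k x f) = f.
Proof.
elim: f k => //= [s t k|s t k|g IHg h IHh k|g IHg k].
- by move=> /andP[? ?]; rewrite !topen_tclose.
- by move=> /andP[? ?]; rewrite !topen_tclose.
- by move=> /andP[? ?]; rewrite IHg ?IHh.
- by move=> ?; rewrite IHg.
Qed.

Lemma tlc_tclose k x t : tlc k t -> tlc k.+1 (tclose k x t).
Proof.
move=> /allP lct; apply/allP => v; rewrite tvars_tmap => /mapP[w /lct + ->].
by case: eqP => //= _; case: w => //= i /ltnW.
Qed.

Lemma flc_fclose k x f : flc k f -> flc k.+1 (fclose k x f).
Proof.
elim: f k => //= [s t k|s t k|g IHg h IHh k|g IHg k].
- by move=> /andP[? ?]; rewrite !tlc_tclose.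
- by move=> /andP[? ?]; rewrite !tlc_tclose.
- by move=> /andP[? ?]; rewrite IHg ?IHh.
- by move=> ?; rewrite IHg.
Qed.

Definition right_var (v : nat + rvar) : option rvar :=
  if v is inr x then Some x else None.

Lemma mem_right_var (s : seq (nat + rvar)) x :
  (x \in pmap right_var s) = (inr x \in s).
Proof. by elim: s => //= -[i|y] s IH /=; rewrite !inE IH. Qed.

Lemma mem_tvars_tclose k x t y :
  (inr y \in tvars (tclose k x t)) = (y != x) && (inr y \in tvars t).
Proof.
rewrite tvars_tmap; apply/mapP/andP => [[v vt]|[yx yt]].
  by case: eqVneq => // nv E; rewrite E vt; split=> //; apply: contra_neq nv => <-.
exists (inr y) => //; case: eqVneq => // -[E].
by rewrite E eqxx in yx.
Qed.

Lemma mem_ffree_fclose k x f y :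
  (y \in ffree (fclose k x f)) = (y != x) && (y \in ffree f).
Proof.
elim: f k => [s t|s t||g IHg h IHh|g IHg] k /=.
- by rewrite !mem_right_var !mem_cat !mem_tvars_tclose andb_orr.
- by rewrite !mem_right_var !mem_cat !mem_tvars_tclose andb_orr.
- by rewrite andbF.
- by rewrite !mem_cat IHg IHh andb_orr.
- exact: IHg.
Qed.

Lemma mem_ffree_fforall xs f y :
  (y \in ffree (foldr fforall f xs)) = (y \notin xs) && (y \in ffree f).
Proof.
elim: xs => //= x xs IH; rewrite mem_ffree_fclose IH inE negb_or.
by rewrite -andbA.
Qed.

Lemma ffree_fo_closure f y : y \notin ffree (fo_closure f).
Proof. by rewrite mem_ffree_fforall mem_undup andNb. Qed.

Lemma flc_fforall xs f : flc 0 f -> flc 0 (foldr fforall f xs).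
Proof. by move=> lf; elim: xs => //= x xs IH; apply: flc_fclose. Qed.

Lemma nd_closure G f xs : flc 0 f ->
  (forall g x, List.In g G -> x \notin ffree g) -> nd G f ->
  nd G (foldr fforall f xs).
Proof.
move=> lf cG Gf; elim: xs => //= x xs IH; apply: (@nd_allI _ _ x).
- by rewrite mem_ffree_fclose eqxx.
- by move=> g /cG.
- by rewrite fopen_fclose // flc_fforall.
Qed.

Lemma tlc_topen k t s : tlc k.+1 s -> tlc k (topen k t s).
Proof.
move=> /allP ls; apply/allP => v; rewrite tvars_tbind => /flatten_mapP[w /ls].
case: eqVneq => [_ _|nw].
  by rewrite tvars_tmap => /mapP[y _ ->].
case: w nw => [i|y] /= nw li; rewrite inE => /eqP -> //=.
rewrite ltn_neqAle -ltnS li andbT; apply: contra_neq nw => -> //.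
Qed.

Lemma flc_fopen k t f : flc k.+1 f -> flc k (fopen k t f).
Proof.
elim: f k => //= [s u k|s u k|g IHg h IHh k|g IHg k].
- by move=> /andP[? ?]; rewrite !tlc_topen.
- by move=> /andP[? ?]; rewrite !tlc_topen.
- by move=> /andP[? ?]; rewrite IHg ?IHh.
- exact: IHg.
Qed.

Lemma closed_fterm t : tlc 0 t -> exists s, t = fterm_of s.
Proof.
rewrite /tlc; elim: t => /= [[//|x] _|_|_|u IH /IH[s ->]|u IHu v IHv|u IHu v IHv].
- by exists (TVar x).
- by exists TZero.
- by exists TOne.
- by exists (TOpp s).
- by rewrite all_cat => /andP[/IHu[s ->] /IHv[s' ->]]; exists (TAdd s s').
- by rewrite all_cat => /andP[/IHu[s ->] /IHv[s' ->]]; exists (TMul s s').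
Qed.

Lemma topen_fterm_of k t s : topen k t (fterm_of s) = fterm_of s.
Proof.
rewrite /topen /fterm_of /tmap tbind_comp.
by elim: s => //= [u ->|u -> v ->|u -> v ->].
Qed.

(** * Semantics of opening, closing and universal closure *)

Section SemanticsLemmas.
Variable M : ostruct.
Implicit Types (b : nat -> M) (rho : rvar -> M).

Lemma otval_tbind (X Y : Type) (s : X -> term Y) (e : Y -> M) t :
  otval e (tbind s t) = otval (fun x => otval e (s x)) t.
Proof. by elim: t => //= [u ->|u -> v ->|u -> v ->]. Qed.

Lemma eq_in_otval (X : eqType) (e e' : X -> M) t :
  {in tvars t, e =1 e'} -> otval e t = otval e' t.
Proof.
elim: t => //= [x H|u IH /IH -> //|u IHu v IHv H|u IHu v IHv H].
- by rewrite H ?mem_head.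
- by rewrite IHu ?IHv // => x xv; apply: H; rewrite mem_cat xv ?orbT.
- by rewrite IHu ?IHv // => x xv; apply: H; rewrite mem_cat xv ?orbT.
Qed.

Lemma otval_fterm_of b rho s : otval (oenv b rho) (fterm_of s) = otval rho s.
Proof. by rewrite otval_tbind; apply: eq_in_otval. Qed.

Lemma eq_osat b b' rho rho' f k :
  flc k f -> (forall i, i < k -> b i = b' i) -> {in ffree f, rho =1 rho'} ->
  osat b rho f <-> osat b' rho' f.
Proof.
have tE b1 b1' j (s t : fterm) : tlc j s && tlc j t ->
    (forall i, i < j -> b1 i = b1' i) ->
    {in pmap right_var (tvars s ++ tvars t), rho =1 rho'} ->
    otval (oenv b1 rho) s = otval (oenv b1' rho') s /\
    otval (oenv b1 rho) t = otval (oenv b1' rho') t.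
  move=> /andP[/allP ls /allP lt] Hb Hr.
  split; apply: eq_in_otval => -[i|x] v /=.
  - by apply: Hb; apply: (ls _ v).
  - by apply: Hr; rewrite mem_right_var mem_cat v.
  - by apply: Hb; apply: (lt _ v).
  - by apply: Hr; rewrite mem_right_var mem_cat v orbT.
elim: f b b' k => [s t|s t||g IHg h IHh|g IHg] b b' k /=.
- by move=> l Hb Hr; have [-> ->] := tE _ _ _ _ _ l Hb Hr.
- by move=> l Hb Hr; have [-> ->] := tE _ _ _ _ _ l Hb Hr.
- by [].
- move=> /andP[lg lh] Hb Hr.
  have Hg := IHg b b' k lg Hb; have Hh := IHh b b' k lh Hb.
  have {}Hg : osat b rho g <-> osat b' rho' g.
    by apply: Hg => x xg; apply: Hr; rewrite mem_cat xg.
  have {}Hh : osat b rho h <-> osat b' rho' h.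
    by apply: Hh => x xg; apply: Hr; rewrite mem_cat xg orbT.
  by rewrite Hg Hh.
- move=> lg Hb Hr; have H m : osat (opush m b) rho g <-> osat (opush m b') rho' g.
    by apply: IHg lg _ Hr => -[|i] //= /Hb.
  by split=> H' m; apply/H.
Qed.

Definition rupd rho (x : rvar) (m : M) : rvar -> M :=
  fun y => if y == x then m else rho y.

Definition bupd b (k : nat) (m : M) : nat -> M := fun i => if i == k then m else b i.

Lemma osat_fclose b rho k x f :
  osat b rho (fclose k x f) <-> osat b (rupd rho x (b k)) f.
Proof.
have tE b1 j (s : fterm) :
    otval (oenv b1 rho) (tclose j x s) = otval (oenv b1 (rupd rho x (b1 j))) s.
  rewrite otval_tbind; apply: eq_in_otval => v _ /=.
  case: eqVneq => [-> /=|]; first by rewrite /rupd eqxx.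
  case: v => //= y nyx; rewrite /rupd; case: eqVneq => // yx.
  by rewrite yx eqxx in nyx.
elim: f b k => [s t|s t||g IHg h IHh|g IHg] b k /=; rewrite ?tE //.
  by rewrite IHg IHh.
by split=> H m; [apply/(IHg (opush m b) k.+1)|apply/(IHg (opush m b) k.+1)]; apply: H.
Qed.

Lemma osat_fopen b rho k t f :
  osat b rho (fopen k t f) <-> osat (bupd b k (otval rho t)) rho f.
Proof.
have tE b1 j (s : fterm) : otval (oenv b1 rho) (topen j t s) =
    otval (oenv (bupd b1 j (otval rho t)) rho) s.
  rewrite otval_tbind; apply: eq_in_otval => v _.
  case: eqVneq => [->|]; first by rewrite otval_fterm_of /= /bupd eqxx.
  case: v => //= i nik; rewrite /bupd; case: eqVneq => // ik.
  by rewrite ik eqxx in nik.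
elim: f b k => [s u|s u||g IHg h IHh|g IHg] b k /=; rewrite ?tE //.
  by rewrite IHg IHh.
have E m : opush m (bupd b k (otval rho t)) =
    bupd (opush m b) k.+1 (otval rho t) by apply: funext => -[].
by split=> H m; have := H m; rewrite ?E => /(IHg (opush m b) k.+1); rewrite ?E.
Qed.

Lemma osat_fforall b rho x f : flc 0 f ->
  osat b rho (fforall x f) <-> forall m, osat b (rupd rho x m) f.
Proof.
move=> lf; rewrite /fforall /=.
have H m : osat (opush m b) rho (fclose 0 x f) <-> osat b (rupd rho x m) f.
  by rewrite osat_fclose; apply: eq_osat lf _ _.
by split=> H' m; apply/H.
Qed.

Lemma osat_fexists b rho x f : flc 0 f ->
  osat b rho (fexists x f) <-> exists m, osat b (rupd rho x m) f.
Proof.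
move=> lf; rewrite /fexists /FNot /=.
have lf' : flc 0 (FNot f) by rewrite /= lf.
have E := osat_fforall b rho x lf'; rewrite /fforall /= in E; rewrite E.
split=> [H|[m Hm] H]; last exact: (H m Hm).
by apply: contrapT => H'; apply: H => m Hm; apply: H'; exists m.
Qed.

Lemma osat_closure b rho rho' f : flc 0 f ->
  osat b rho (fo_closure f) -> osat b rho' f.
Proof.
move=> lf; rewrite /fo_closure.
have H xs r r' : osat b r (foldr fforall f xs) ->
    (forall x, x \notin xs -> r' x = r x) -> osat b r' f.
  elim: xs r => [|x xs IH] r /=.
    by move=> + E; apply: (eq_osat lf _ _).1 => // x _; rewrite E.
  move=> /(osat_fforall b r x (flc_fforall xs lf)).1 /(_ (r' x)) H E.
  apply: IH H _ => y yxs; rewrite /rupd; case: eqVneq => [-> //|yx].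
  by rewrite E // inE negb_or yx.
(* The closure lets only the free variables of [f] vary, so [rho'] is used on these and [rho]
   elsewhere. *)
move=> Hc; pose r' x := if x \in ffree f then rho' x else rho x.
have : osat b r' f.
  by apply: H Hc _ => x; rewrite mem_undup /r' => /negPf ->.
by apply: (eq_osat lf _ _).1 => // x xf; rewrite /r' xf.
Qed.

Lemma osat_FImp b rho f g :
  osat b rho (FImp f g) = (osat b rho f -> osat b rho g).
Proof. by []. Qed.

Lemma osat_FAnd b rho f g : osat b rho (FAnd f g) <-> osat b rho f /\ osat b rho g.
Proof.
rewrite /=; split=> [H|[Hf Hg] H]; last exact: H.
by split; apply: contrapT => H'; apply: H => h1 h2; apply: H'.
Qed.

Lemma osat_FOr b rho f g : osat b rho (FOr f g) <-> osat b rho f \/ osat b rho g.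
Proof.
rewrite /=; split=> [H|[Hf|Hg] H] //.
by have [hf|hf] := pselect (osat b rho f); [left|right; apply: H].
Qed.

End SemanticsLemmas.

(** * Countability of the set of formulas *)

Section Coding.
Local Notation tree := (GenTree.tree nat).
Local Notation leaf := (@GenTree.Leaf nat).
Local Notation node := (@GenTree.Node nat).

Fixpoint cform_code (a : cform) : tree :=
  match a with
  | CTop => node 0 [::]
  | CSym j => leaf j
  | CNot b => node 1 [:: cform_code b]
  | CImp b c => node 2 [:: cform_code b; cform_code c]
  end.

Lemma cform_code_inj : injective cform_code.
Proof.
elim=> [|j|a IHa|a IHa b IHb] [|j'|a'|a' b'] //=.
- by case=> ->.
- by case=> /IHa ->.
- by case=> /IHa -> /IHb ->.
Qed.

Definition var_code (v : nat + rvar) : tree :=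
  match v with
  | inl k => node 0 [:: leaf k]
  | inr (VNum k) => node 1 [:: leaf k]
  | inr (VForm a) => node 2 [:: cform_code a]
  | inr (VPair A) => node 3 [:: leaf (choice.pickle A)]
  end.

Lemma var_code_inj : injective var_code.
Proof.
case=> [k|[k|a|A]] [k'|[k'|a'|A']] //= [].
- by move=> ->.
- by move=> ->.
- by move=> /cform_code_inj ->.
- by move=> /(pcan_inj choice.pickleK) ->.
Qed.

Fixpoint term_code (t : fterm) : tree :=
  match t with
  | TVar v => node 0 [:: var_code v]
  | TZero => node 1 [::]
  | TOne => node 2 [::]
  | TOpp u => node 3 [:: term_code u]
  | TAdd u v => node 4 [:: term_code u; term_code v]
  | TMul u v => node 5 [:: term_code u; term_code v]
  end.

Lemma term_code_inj : injective term_code.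
Proof.
elim=> [v|||u IHu|u IHu v IHv|u IHu v IHv] [v'|||u'|u' v'|u' v'] //= [].
- by move=> /var_code_inj ->.
- by move=> /IHu ->.
- by move=> /IHu -> /IHv ->.
- by move=> /IHu -> /IHv ->.
Qed.

Fixpoint fo_code (f : fo) : tree :=
  match f with
  | FEq s t => node 0 [:: term_code s; term_code t]
  | FLt s t => node 1 [:: term_code s; term_code t]
  | FBot => node 2 [::]
  | FImp g h => node 3 [:: fo_code g; fo_code h]
  | FAll g => node 4 [:: fo_code g]
  end.

Lemma fo_code_inj : injective fo_code.
Proof.
elim=> [s t|s t||g IHg h IHh|g IHg] [s' t'|s' t'||g' h'|g'] //= [].
- by move=> /term_code_inj -> /term_code_inj ->.
- by move=> /term_code_inj -> /term_code_inj ->.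
- by move=> /IHg -> /IHh ->.
- by move=> /IHg ->.
Qed.

Lemma fo_enumeration : exists e : nat -> fo, forall f, exists n, e n = f.
Proof.
have [|e He] := @choice nat fo (fun n f => forall f', choice.pickle (fo_code f') = n -> f' = f).
  move=> n; have [[f Hf]|nf] := pselect (exists f, choice.pickle (fo_code f) = n).
    by exists f => f'; rewrite -Hf => /(pcan_inj choice.pickleK)/fo_code_inj.
  by exists FBot => f' Hf'; case: nf; exists f'.
by exists e => f; exists (choice.pickle (fo_code f)); rewrite -(He _ f).
Qed.

End Coding.

Lemma fresh_var (xs : seq rvar) : exists x, x \notin xs.
Proof.
pose ix x := if x is VNum n then n else 0.
exists (VNum (\max_(x <- xs) ix x).+1); apply/negP => h.
by have := @leq_bigmax_seq _ xs xpredT ix _ h isT; rewrite /= ltnn.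
Qed.

Lemma In_cat (T : Type) (x : T) (s t : seq T) :
  List.In x (s ++ t) <-> List.In x s \/ List.In x t.
Proof. by elim: s => [|y s IH] /=; [tauto|rewrite IH; tauto]. Qed.

Lemma ffree_flatten (G : seq fo) (f : fo) x :
  x \notin flatten (map ffree G) -> List.In f G -> x \notin ffree f.
Proof.
elim: G => //= g G IH; rewrite mem_cat negb_or => /andP[xg xG] [<- //|].
exact: IH.
Qed.

(** * Henkin extension of a consistent list of formulas *)

Section Henkin.
Variable Ax : fo -> Prop.
Hypothesis Ax_closed : forall f x, Ax f -> x \notin ffree f.
Implicit Types (L : seq fo) (f g h : fo).

(** The axioms stay apart from the finite list [L]: there may be infinitely many, but they are
    closed, so a variable fresh for [L] is fresh for all hypotheses. *)
Definition prv L f :=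
  exists2 G : seq fo, (forall g, List.In g G -> Ax g) & nd (L ++ G) f.

Lemma prv_nd L f : nd L f -> prv L f.
Proof. by move=> Lf; exists [::] => //; rewrite cats0. Qed.

Lemma prv_ax L f : Ax f -> prv L f.
Proof.
move=> Af; exists [:: f] => [g [<-|[]] //|]; apply: nd_hyp.
by apply/In_cat; right; left.
Qed.

Lemma prv_weak L L' f : (forall g, List.In g L -> List.In g L') -> prv L f -> prv L' f.
Proof.
move=> LL' [G AG Gf]; exists G => //; apply: nd_weak Gf => g.
by rewrite !In_cat => -[/LL' ?|?]; [left|right].
Qed.

Lemma prv_impI L f g : prv (f :: L) g -> prv L (FImp f g).
Proof. by move=> [G AG Gf]; exists G => //; apply: nd_impI. Qed.

Lemma prv_impE L f g : prv L (FImp f g) -> prv L f -> prv L g.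
Proof.
move=> [G AG Gf] [G' AG' Gf']; exists (G ++ G').
  by move=> h /In_cat[/AG|/AG'].
apply: (@nd_impE _ f); [apply: nd_weak Gf|apply: nd_weak Gf'] => h;
  by rewrite !In_cat; tauto.
Qed.

Lemma prv_raa L f : prv (FNot f :: L) FBot -> prv L f.
Proof. by move=> [G AG Gf]; exists G => //; apply: nd_raa. Qed.

Lemma prv_allI L f x : x \notin ffree f -> (forall g, List.In g L -> x \notin ffree g) ->
  prv L (fopen 0 (TVar x) f) -> prv L (FAll f).
Proof.
move=> xf xL [G AG Gf]; exists G => //; apply: nd_allI Gf => // g.
by move=> /In_cat[/xL //|/AG /Ax_closed].
Qed.

Definition consistent L := ~ prv L FBot.

(** Witnesses are ordinary variables; as [L] is finite, a fresh one always exists and the language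
    need not grow. If the witnessing formula were inconsistent with the rest, generalising over the
    fresh variable would give [FAll h], against [f]. *)
Lemma henkin_step L f : consistent L -> exists L', [/\ consistent L',
  forall g, List.In g L -> List.In g L' &
  prv (f :: L) FBot \/ (List.In f L' /\ forall h, f = FNot (FAll h) ->
     exists x, List.In (FNot (fopen 0 (TVar x) h)) L')].
Proof.
move=> cL; have [incon|con] := pselect (prv (f :: L) FBot).
  by exists L; split=> //; left.
have [[h fE]|nh] := pselect (exists h, f = FNot (FAll h)); last first.
  exists (f :: L); split=> //; first by right.
  by right; split; [left|move=> h fE; case: nh; exists h].
have [x xf] := fresh_var (flatten (map ffree (h :: f :: L))).
exists (FNot (fopen 0 (TVar x) h) :: f :: L); split.
- move=> /prv_raa H; apply: con; apply: (@prv_impE _ (FAll h)).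
    by rewrite fE; apply/prv_nd/nd_hyp; left.
  apply: prv_allI H.
    by apply: (ffree_flatten xf); left.
  by move=> g gL; apply: (ffree_flatten xf); right.
- by move=> g gL; right; right.
- right; split; first by right; left.
  by move=> h'; rewrite fE => -[<-]; exists x; left.
Qed.

Theorem henkin_theory L0 : consistent L0 -> exists Th : fo -> Prop,
  [/\ forall f, prv L0 f -> Th f, ~ Th FBot,
      forall L f, (forall g, List.In g L -> Th g) -> nd L f -> Th f,
      forall f, Th f \/ Th (FNot f)
    & forall h, (forall t, Th (fopen 0 t h)) -> Th (FAll h)].
Proof.
move=> c0; have [e He] := fo_enumeration.
pose St := {L : seq fo | consistent L}.
have [step Hstep] : exists step : St -> fo -> St, forall (L : St) f,
    (forall g, List.In g (sval L) -> List.In g (sval (step L f))) /\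
    (prv (f :: sval L) FBot \/ (List.In f (sval (step L f)) /\
       forall h, f = FNot (FAll h) ->
         exists x, List.In (FNot (fopen 0 (TVar x) h)) (sval (step L f)))).
  have [|stp H] := @choice (St * fo) St (fun Lf (L' : St) =>
    (forall g, List.In g (sval Lf.1) -> List.In g (sval L')) /\
    (prv (Lf.2 :: sval Lf.1) FBot \/ (List.In Lf.2 (sval L') /\
       forall h, Lf.2 = FNot (FAll h) ->
         exists x, List.In (FNot (fopen 0 (TVar x) h)) (sval L')))).
    move=> [[L cL] f] /=; have [L' [cL' LL' H]] := henkin_step f cL.
    by exists (exist _ L' cL').
  by exists (fun (K : St) f => stp (K, f)) => K f; apply: (H (K, f)).
pose chain := fix chain n : St :=
  if n is n'.+1 then step (chain n') (e n') else exist _ L0 c0.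
have chain_le m n g : m <= n -> List.In g (sval (chain m)) -> List.In g (sval (chain n)).
  move=> /subnK <-; elim: (n - m) => //= k IH /IH.
  by apply: (Hstep _ _).1.
pose Th f := exists n, prv (sval (chain n)) f.
have Th_mp f g : Th (FImp f g) -> Th f -> Th g.
  move=> [m Hm] [n Hn]; exists (maxn m n); apply: (@prv_impE _ f).
    by apply: prv_weak Hm => k; apply: chain_le; rewrite leq_maxl.
  by apply: prv_weak Hn => k; apply: chain_le; rewrite leq_maxr.
have Th_con : ~ Th FBot by move=> [n]; apply: (svalP (chain n)).
have Th_nd L f : (forall g, List.In g L -> Th g) -> nd L f -> Th f.
  elim: L f => [|g L IH] f HL Lf.
    by exists 0; apply/prv_nd; apply: nd_weak Lf.
  apply: (Th_mp g); last by apply: HL; left.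
  by apply: IH (nd_impI Lf) => h hL; apply: HL; right.
have Th_in n f : List.In f (sval (chain n)) -> Th f.
  by move=> nf; exists n; apply/prv_nd/nd_hyp.
have Th_cpl f : Th f \/ Th (FNot f).
  have [n <-] := He f; have [_ [H|[H _]]] := Hstep (chain n) (e n).
    by right; exists n; apply: prv_impI.
  by left; apply: (Th_in n.+1).
exists Th; split=> //; first by move=> f; exists 0.
move=> h Hh; case: (Th_cpl (FAll h)) => // nA; exfalso.
(* The stage treating this formula either refuted it or added a witness, and each contradicts the
   assumptions. *)
have [n En] := He (FNot (FAll h)).
have [_ [H|[_ H]]] := Hstep (chain n) (e n).
  apply: Th_con; apply: (Th_mp (FNot (FAll h))) => //.
  by exists n; apply: prv_impI; rewrite -En.
have [x Hx] := H _ En; apply: Th_con.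
by apply: (Th_mp (fopen 0 (TVar x) h)) (Hh _); apply: (Th_in n.+1).
Qed.

End Henkin.

Lemma tlc_generic_poly n t : tlc 0 t -> tlc 0 (generic_poly n t).
Proof.
rewrite /generic_poly /tlc => lt; elim: (iota _ _) => //= k s IH.
by rewrite all_cat lt.
Qed.

Lemma flc_FAnd k f g : flc k (FAnd f g) = flc k f && flc k g.
Proof. by rewrite /= !andbT. Qed.

Lemma flc_FLe k s t : flc k (FLe s t) = tlc k s && tlc k t.
Proof. by rewrite /= !andbT andbb. Qed.

Lemma flc_fexists x f : flc 0 f -> flc 0 (fexists x f).
Proof. by move=> lf; rewrite /= !andbT; apply: flc_fclose. Qed.

Definition poly_ivt_matrix (n : nat) : fo :=
  FImp (FAnd (FLe (fvar (VNum n.+1)) (fvar (VNum n.+2)))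
         (FAnd (FLe (generic_poly n (fvar (VNum n.+1))) TZero)
               (FLe TZero (generic_poly n (fvar (VNum n.+2))))))
       (fexists (VNum n.+3)
         (FAnd (FAnd (FLe (fvar (VNum n.+1)) (fvar (VNum n.+3)))
                     (FLe (fvar (VNum n.+3)) (fvar (VNum n.+2))))
               (FEq (generic_poly n (fvar (VNum n.+3))) TZero))).

Lemma flc_poly_ivt_body n :
  flc 0 (FAnd (FAnd (FLe (fvar (VNum n.+1)) (fvar (VNum n.+3)))
                    (FLe (fvar (VNum n.+3)) (fvar (VNum n.+2))))
              (FEq (generic_poly n (fvar (VNum n.+3))) TZero)).
Proof. by rewrite !flc_FAnd !flc_FLe /= tlc_generic_poly. Qed.

Lemma flc_poly_ivt n : flc 0 (poly_ivt_matrix n).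
Proof.
have flc_FImp f g : flc 0 (FImp f g) = flc 0 f && flc 0 g by [].
rewrite flc_FImp (flc_fexists _ (flc_poly_ivt_body n)) andbT.
by rewrite !flc_FAnd !flc_FLe !tlc_generic_poly.
Qed.

Lemma rcof_axiom_closed f x : rcof_axiom f -> x \notin ffree f.
Proof. by case=> *; rewrite ?ffree_fo_closure. Qed.

Lemma rcof_axiom_lc f : rcof_axiom f -> flc 0 f.
Proof.
by case=> [|||||||||||||||n] //; apply: flc_fforall => //; apply: flc_poly_ivt.
Qed.

(** * Models of the axioms as real closed fields *)

Section RealClosedModel.
Variable M : ostruct.
Hypothesis M_rcof : forall f, rcof_axiom f -> forall b rho, osat (M := M) b rho f.

Let env3 (x y z : M) (v : rvar) : M :=
  match v with VNum 0 => x | VNum 1 => y | _ => z end.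

Let nob (_ : nat) : M := ozero M.

(** The closed axioms on field and order use only the variables 0, 1 and 2, so three values
    instantiate them. *)
Let law f (x y z : M) : rcof_axiom (fo_closure f) -> flc 0 f ->
  osat nob (env3 x y z) f.
Proof. by move=> + lf => /M_rcof /(_ nob (env3 x y z)) /(osat_closure (env3 x y z) lf). Qed.

Definition model : Type := ocar M.

HB.instance Definition _ := gen_eqMixin model.
HB.instance Definition _ := gen_choiceMixin model.

Let maddA : associative (oadd (o := M)).
Proof. by move=> x y z; exact: (law x y z rcof_addA isT). Qed.
Let maddC : commutative (oadd (o := M)).
Proof. by move=> x y; exact: (law x y y rcof_addC isT). Qed.
Let madd0 : left_id (ozero M) (oadd (o := M)).
Proof. by move=> x; rewrite maddC; exact: (law x x x rcof_add0 isT). Qed.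
Let maddN : left_inverse (ozero M) (oopp (o := M)) (oadd (o := M)).
Proof. by move=> x; rewrite maddC; exact: (law x x x rcof_addN isT). Qed.

HB.instance Definition _ := GRing.isZmodule.Build model maddA maddC madd0 maddN.

Let mmulA : associative (omul (o := M)).
Proof. by move=> x y z; exact: (law x y z rcof_mulA isT). Qed.
Let mmulC : commutative (omul (o := M)).
Proof. by move=> x y; exact: (law x y y rcof_mulC isT). Qed.
Let mmul1 : left_id (oone M) (omul (o := M)).
Proof. by move=> x; rewrite mmulC; exact: (law x x x rcof_mul1 isT). Qed.
Let mmulD : left_distributive (omul (o := M)) (oadd (o := M)).
Proof.
move=> x y z; rewrite mmulC (mmulC x) (mmulC y).
by exact: (law z x y rcof_mulD isT).
Qed.
Let mneq01 : (oone M : model) != 0%R.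
Proof.
apply/eqP => E; have := M_rcof rcof_neq01 nob (fun=> ozero M); apply.
by rewrite /= E.
Qed.

HB.instance Definition _ :=
  GRing.Zmodule_isComNzRing.Build model mmulA mmulC mmul1 mmulD mneq01.

(** The second clause makes the chosen inverse of 0 equal to 0, as the field interface demands. *)
Let minv_ex (x : model) : exists y : model,
  (x != 0 -> y * x = 1)%R /\ (x = 0 -> y = 0)%R.
Proof.
have [->|x0] := eqVneq x 0%R; first by exists 0%R.
have H : osat nob (env3 x x x)
    (fexists (VNum 1) (FEq (TMul (fvar (VNum 0)) (fvar (VNum 1))) TOne)).
  by apply: (law x x x rcof_mulV isT) => E; case/eqP: x0.
have [//|y Hy] := (osat_fexists _ _ _ _).1 H.
exists y; split; last by move=> E; rewrite E eqxx in x0.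
by move=> _; rewrite mulrC.
Qed.

Let minv (x : model) : model := sval (cid (minv_ex x)).
Let mmulV (x : model) : (x != 0 -> minv x * x = 1)%R.
Proof. by rewrite /minv; case: cid => y []. Qed.
Let minv0 : minv 0%R = 0%R.
Proof. by rewrite /minv; case: cid => y /= [_]; apply. Qed.

HB.instance Definition _ := GRing.ComNzRing_isField.Build model mmulV minv0.

Let mlt (x y : model) : bool := `[< olt (o := M) x y >].
Let mle (x y : model) : bool := (x == y) || mlt x y.
Let mnorm (x : model) : model := if mle 0%R x then x else (- x)%R.

Let mltP (x y : model) : reflect (olt (o := M) x y) (mlt x y).
Proof. exact: asboolP. Qed.

Let mltxx x : mlt x x = false.
Proof. by apply/mltP; have := law x x x rcof_ltxx isT. Qed.

Let mlt_trans x y z : mlt x y -> mlt y z -> mlt x z.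
Proof.
move=> /mltP xy /mltP yz; apply/mltP.
by apply: (law x y z rcof_lt_trans isT) => H; apply: (H xy yz).
Qed.

Let mlt_total x y : mlt x y \/ x = y \/ mlt y x.
Proof.
have /osat_FOr[/mltP|/osat_FOr[|/mltP]] := law x y y rcof_lt_total isT; tauto.
Qed.

Let mltD x y z : mlt x y -> mlt (x + z)%R (y + z)%R.
Proof. by move=> /mltP xy; apply/mltP; exact: (law x y z rcof_ltD isT). Qed.

Let mltM x y : mlt 0%R x -> mlt 0%R y -> mlt 0%R (x * y)%R.
Proof.
move=> /mltP x0 /mltP y0; apply/mltP.
by apply: (law x y y rcof_ltM isT) => H; apply: (H x0 y0).
Qed.

Let mlt0_add x y : mlt 0%R x -> mlt 0%R y -> mlt 0%R (x + y)%R.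
Proof. by move=> x0 y0; apply: mlt_trans y0 _; rewrite -[y in mlt y]add0r mltD. Qed.

Let mlt0_ngt0 x : mlt 0%R x -> ~~ mlt x 0%R.
Proof. by move=> x0; apply/negP => /(mlt_trans x0); rewrite mltxx. Qed.

Let msub_gt0 x y : mlt 0%R (y - x)%R = mlt x y.
Proof.
by apply/idP/idP => [/(mltD x)|/(mltD (- x)%R)]; rewrite ?add0r ?subrK ?subrr.
Qed.

Let mlt0_total x : x != 0%R -> mlt 0%R x || mlt x 0%R.
Proof. by have [->|[<-|->]] := mlt_total 0%R x; rewrite ?eqxx ?orbT. Qed.

Let mnormN x : mnorm (- x)%R = mnorm x.
Proof.
rewrite /mnorm /mle opprK ![0%R == _]eq_sym oppr_eq0.
have [->|x0 /=] := eqVneq x 0%R; first by rewrite oppr0.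
have E : mlt 0%R (- x)%R = mlt x 0%R by rewrite -[RHS]msub_gt0 add0r.
rewrite E; case: (boolP (mlt 0%R x)) => [/mlt0_ngt0/negPf -> //|nx].
by have := mlt0_total x0; rewrite (negPf nx) /= => ->.
Qed.

Let mge0_norm x : mle 0%R x -> mnorm x = x.
Proof. by rewrite /mnorm => ->. Qed.

Let mle_def x y : mle x y = (x == y) || mlt x y. Proof. by []. Qed.

HB.instance Definition _ := Num.IntegralDomain_isLtReal.Build model
  mlt0_add mltM mlt0_ngt0 msub_gt0 mlt0_total mnormN mge0_norm mle_def.

Let otval_model (X : Type) (e : X -> M) (t : term X) :
  otval e t = @otval (ring_ostruct model) X e t.
Proof. by elim: t => //= [u ->|u -> v ->|u -> v ->]. Qed.

Lemma osat_model b rho f :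
  osat (M := M) b rho f <-> @osat (ring_ostruct model) b rho f.
Proof.
elim: f b => //= [s t|s t|g IHg h IHh|g IHg] b.
- by rewrite !otval_model.
- by rewrite !otval_model; apply: rwP (mltP _ _).
- by rewrite IHg IHh.
- by split=> H m; apply/IHg.
Qed.

Let osat_FLe (b : nat -> model) (rho : rvar -> model) s t : @osat (ring_ostruct model) b rho (FLe s t) <->
  (teval (oenv b rho) s <= teval (oenv b rho) t :> model)%R.
Proof.
rewrite osat_FOr /= !otval_ring le_eqVlt; split=> [[->|->]|/orP[/eqP ->|]].
- by rewrite orbT.
- by rewrite eqxx.
- by right.
- by left.
Qed.

Let generic_polyE (p : {poly model}) n (b : nat -> model) (rho : rvar -> model) t : size p <= n.+1 ->
  (forall k, (k <= n)%N -> rho (VNum k) = p`_k)%R ->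
  teval (oenv b rho) (generic_poly n t) = (p.[teval (oenv b rho) t])%R.
Proof.
move=> sp Hrho; set x := teval _ t; rewrite (horner_coef_wide x sp) /generic_poly.
have H m l : m + l <= n.+1 -> teval (oenv b rho)
    (foldr (fun k u => TAdd (fvar (VNum k)) (TMul t u)) TZero (iota m l)) =
    (\sum_(i < l) p`_(m + i) * x ^+ i)%R.
  elim: l m => [|l IH] m ml /=; first by rewrite big_ord0.
  rewrite big_ord_recl addn0 expr0 mulr1 Hrho; last first.
    by rewrite -ltnS (leq_trans _ ml) // addnS ltnS leq_addr.
  rewrite IH ?addSnnS // mulr_sumr; congr (_ + _)%R; apply: eq_bigr => i _.
  by rewrite exprS mulrCA addSnnS.
by rewrite (H 0 n.+1).
Qed.

Let model_ivt : Num.real_closed_axiom model.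
Proof.
(* The generic polynomial of index [n] has [n.+1] coefficients, one more than the size of [p]; the
   last is 0. *)
move=> p a b ab /andP[pa pb]; pose n := size p.
pose r v : model := match v with
  | VNum k => if (k <= n)%N then p`_k
              else if k == n.+1 then a else if k == n.+2 then b else 0
  | _ => 0 end%R.
have rp k : k <= n -> r (VNum k) = (p`_k)%R by rewrite /r => ->.
have ra : r (VNum n.+1) = a by rewrite /r ltnn eqxx.
have rb : r (VNum n.+2) = b.
  by rewrite /r ltnNge leqnSn /= eqn_leq ltnn /= eqxx.
clearbody r; have := M_rcof (rcof_poly_ivt n) nob r => /(osat_closure r (flc_poly_ivt n)).
move=> /(osat_model nob r _).1; rewrite /poly_ivt_matrix osat_FImp => H.
have [|c] := (osat_fexists (M := ring_ostruct model) nob r (VNum n.+3)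
    (flc_poly_ivt_body n)).1 (H _).
  apply/osat_FAnd; split; first by apply/osat_FLe; rewrite /= ra rb.
  apply/osat_FAnd; split; apply/osat_FLe.
  - by rewrite (generic_polyE (p := p)) //= ra.
  - by rewrite (generic_polyE (p := p)) //= rb.
set r' := rupd _ _ _.
have r'p k : k <= n -> r' (VNum k) = (p`_k)%R.
  move=> kn; rewrite /r' /rupd; case: eqVneq => [[E]|_]; last exact: rp.
  by rewrite E -ltnS ltnNge -addn2 leq_addr in kn.
have r'a : r' (VNum n.+1) = a.
  by rewrite /r' /rupd; case: eqVneq => [[/eqP]|//]; rewrite (ltn_eqF (ltnW (ltnSn n.+1))).
have r'b : r' (VNum n.+2) = b.
  by rewrite /r' /rupd; case: eqVneq => [[/eqP]|//]; rewrite (ltn_eqF (ltnSn n)).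
have r'c : r' (VNum n.+3) = c by rewrite /r' /rupd eqxx.
move=> /osat_FAnd[/osat_FAnd[/osat_FLe ac /osat_FLe cb] pc].
have := etrans (esym (otval_ring _ _)) pc.
rewrite (generic_polyE (p := p)) //= r'c => {}pc.
exists c; last exact/rootP.
by move: ac cb; rewrite /= r'a r'b r'c => -> ->.
Qed.

HB.instance Definition _ := Num.RealField_isClosed.Build model model_ivt.

Lemma rcof_model_rcf : exists (F : rcfType) (h : M -> F), forall b rho f,
  osat (M := M) b rho f <-> @osat (ring_ostruct F) (h \o b) (h \o rho) f.
Proof. by exists model, id => b rho f; apply: osat_model. Qed.

End RealClosedModel.

(** * The term model of a Henkin theory *)

Section TermModel.
Variable Th : fo -> Prop.
Hypothesis Th_con : ~ Th FBot.
Hypothesis Th_nd : forall L f, (forall g, List.In g L -> Th g) -> nd L f -> Th f.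
Hypothesis Th_cpl : forall f, Th f \/ Th (FNot f).
Hypothesis Th_all : forall h, (forall t, Th (fopen 0 t h)) -> Th (FAll h).

Let Th_mp f g : Th (FImp f g) -> Th f -> Th g.
Proof.
move=> fg ff; apply: (@Th_nd [:: FImp f g; f]); first by move=> h [<-|[<-|[]]].
by apply: (@nd_impE _ f); apply: nd_hyp; [left|right; left].
Qed.

Let Th_imp f g : Th (FImp f g) <-> (Th f -> Th g).
Proof.
split=> [|fg]; first exact: Th_mp.
have [/fg gg|nf] := Th_cpl f.
  apply: (@Th_nd [:: g]); first by move=> h [<-|[]].
  by apply: nd_impI; apply: nd_hyp; right; left.
apply: (@Th_nd [:: FNot f]); first by move=> h [<-|[]].
apply: nd_impI; apply: nd_raa; apply: (@nd_impE _ f); apply: nd_hyp.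
  by right; right; left.
by right; left.
Qed.

Let Th_allE h t : Th (FAll h) -> Th (fopen 0 t h).
Proof.
move=> hh; apply: (@Th_nd [:: FAll h]); first by move=> g [<-|[]].
by apply: nd_allE; apply: nd_hyp; left.
Qed.

Let eqv (s t : term rvar) := Th (FEq (fterm_of s) (fterm_of t)).

(** The equality rule rewrites at the dangling index 0, so a context is an expression containing
    this index. *)
Let hole : fterm := TVar (inl 0).

Let eqv_subst f s t : eqv s t -> Th (fopen 0 s f) -> Th (fopen 0 t f).
Proof.
move=> st fs; apply: (@Th_nd [:: FEq (fterm_of s) (fterm_of t); fopen 0 s f]).
  by move=> g [<-|[<-|[]]].
by apply: (@nd_eqE _ _ s); apply: nd_hyp; [left|right; left].
Qed.

Let topen_hole t : topen 0 t hole = fterm_of t.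
Proof. by []. Qed.

Let eqv_refl s : eqv s s.
Proof. by apply: (@Th_nd [::]) => //; apply: nd_eqI. Qed.

Let eqv_sym s t : eqv s t -> eqv t s.
Proof.
move=> st; have := @eqv_subst (FEq hole (fterm_of s)) _ _ st.
by rewrite /= !topen_hole !topen_fterm_of; apply; apply: eqv_refl.
Qed.

Let eqv_trans s t u : eqv s t -> eqv t u -> eqv s u.
Proof.
move=> st tu; have := @eqv_subst (FEq (fterm_of s) hole) _ _ tu.
by rewrite /= !topen_hole !topen_fterm_of; apply.
Qed.

Let eqv_congr (c : fterm -> fterm) (c' : term rvar -> term rvar) s t :
  (forall u, topen 0 u (c hole) = fterm_of (c' u)) ->
  eqv s t -> eqv (c' s) (c' t).
Proof.
move=> cE st; have := @eqv_subst (FEq (fterm_of (c' s)) (c hole)) _ _ st.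
by rewrite /= !cE !topen_fterm_of; apply; apply: eqv_refl.
Qed.

(** The quotient of the terms by provable equality. A class is its own membership predicate, so
    extensionality turns equivalent terms into equal elements. *)
Let carrier := {A : term rvar -> Prop | exists t, A = eqv t}.
Let cls (t : term rvar) : carrier := exist _ (eqv t) (ex_intro _ t erefl).

Let clsP s t : cls s = cls t <-> eqv s t.
Proof.
split=> [[E]|st]; first by rewrite E.
apply: eq_exist; apply: funext => u; apply: propext.
by split; apply: eqv_trans => //; apply: eqv_sym.
Qed.

Let cls_surj (m : carrier) : exists t, cls t = m.
Proof. by case: m => A [t E]; exists t; apply: eq_exist. Qed.

Let rep (m : carrier) : term rvar := sval (cid (cls_surj m)).
Let repK m : cls (rep m) = m.
Proof. by rewrite /rep; case: cid. Qed.

Let rep_cls t : eqv (rep (cls t)) t.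
Proof. by apply/clsP; rewrite repK. Qed.

Let term_model : ostruct := @OStruct carrier (cls TZero) (cls TOne)
  (fun m => cls (TOpp (rep m)))
  (fun m n => cls (TAdd (rep m) (rep n)))
  (fun m n => cls (TMul (rep m) (rep n)))
  (fun m n => Th (FLt (fterm_of (rep m)) (fterm_of (rep n)))).

Let eqv_add s s' t t' : eqv s s' -> eqv t t' -> eqv (TAdd s t) (TAdd s' t').
Proof.
move=> ss tt; apply: (@eqv_trans _ (TAdd s' t)).
  apply: (@eqv_congr (fun h => TAdd h (fterm_of t)) (fun u => TAdd u t)) ss => u.
  by rewrite -[LHS]/(TAdd (topen 0 u hole) (topen 0 u (fterm_of t))) topen_hole topen_fterm_of.
apply: (@eqv_congr (fun h => TAdd (fterm_of s') h) (fun u => TAdd s' u)) tt => u.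
by rewrite -[LHS]/(TAdd (topen 0 u (fterm_of s')) (topen 0 u hole)) topen_hole topen_fterm_of.
Qed.

Let eqv_mul s s' t t' : eqv s s' -> eqv t t' -> eqv (TMul s t) (TMul s' t').
Proof.
move=> ss tt; apply: (@eqv_trans _ (TMul s' t)).
  apply: (@eqv_congr (fun h => TMul h (fterm_of t)) (fun u => TMul u t)) ss => u.
  by rewrite -[LHS]/(TMul (topen 0 u hole) (topen 0 u (fterm_of t))) topen_hole topen_fterm_of.
apply: (@eqv_congr (fun h => TMul (fterm_of s') h) (fun u => TMul s' u)) tt => u.
by rewrite -[LHS]/(TMul (topen 0 u (fterm_of s')) (topen 0 u hole)) topen_hole topen_fterm_of.
Qed.

Let eqv_opp s s' : eqv s s' -> eqv (TOpp s) (TOpp s').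
Proof.
apply: (@eqv_congr (fun h => TOpp h) (fun u => TOpp u)) => u.
by rewrite -[LHS]/(TOpp (topen 0 u hole)) topen_hole.
Qed.

Let eqv_lt s s' t t' : eqv s s' -> eqv t t' ->
  Th (FLt (fterm_of s) (fterm_of t)) -> Th (FLt (fterm_of s') (fterm_of t')).
Proof.
move=> ss tt; have := @eqv_subst (FLt hole (fterm_of t)) _ _ ss.
have := @eqv_subst (FLt (fterm_of s') hole) _ _ tt.
by rewrite /= !topen_hole !topen_fterm_of; auto.
Qed.

Let rho0 (x : rvar) : term_model := cls (TVar x).

Let otval_cls t : otval rho0 t = cls t.
Proof.
elim: t => //= [u ->|u -> v ->|u -> v ->]; apply/clsP.
- exact/eqv_opp/rep_cls.
- exact: eqv_add (rep_cls _) (rep_cls _).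
- exact: eqv_mul (rep_cls _) (rep_cls _).
Qed.

Fixpoint fsize (f : fo) : nat :=
  match f with
  | FImp g h => (fsize g + fsize h).+1
  | FAll g => (fsize g).+1
  | _ => 0
  end.

Let fsize_fopen k t f : fsize (fopen k t f) = fsize f.
Proof. by elim: f k => //= [g IHg h IHh|g IHg] k; rewrite ?IHg ?IHh. Qed.

(** The induction is on [fsize], since an instance of a universal formula is not a subformula but
    opening preserves this size. Every element is the class of a term, so [Th_all] settles the
    quantifier. *)
Lemma truth b f : flc 0 f -> osat (M := term_model) b rho0 f <-> Th f.
Proof.
have [n] := ubnP (fsize f); elim: n f b => // n IH [s t|s t||g h|g] b /= sf lf.
- have /andP[/closed_fterm[s' ->] /closed_fterm[t' ->]] := lf.
  by rewrite !otval_fterm_of !otval_cls; apply: clsP.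
- have /andP[/closed_fterm[s' ->] /closed_fterm[t' ->]] := lf.
  rewrite !otval_fterm_of !otval_cls; split; apply: eqv_lt;
    by [apply: rep_cls|apply: eqv_sym; apply: rep_cls].
- by split.
- have /andP[lg lh] := lf; have sg : fsize g < n by apply: leq_ltn_trans (leq_addr _ _) sf.
  have sh : fsize h < n by apply: leq_ltn_trans (leq_addl _ _) sf.
  by rewrite Th_imp (IH g) // (IH h).
have E t : osat (opush (cls t) b : nat -> term_model) rho0 g <-> Th (fopen 0 t g).
  rewrite -(IH (fopen 0 t g) (opush (cls t) b)).
  - rewrite osat_fopen otval_cls.
    by apply: (eq_osat lf) => // -[].
  - by rewrite fsize_fopen.
  - exact: flc_fopen.
split=> [H|/Th_allE H m]; first by apply: Th_all => t; apply/E/H.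
by have [t <-] := cls_surj m; apply/E.
Qed.

Lemma term_model_rcf : (forall f, rcof_axiom f -> Th f) ->
  exists (F : rcfType) b rho, forall f, flc 0 f ->
    @osat (ring_ostruct F) b rho f <-> Th f.
Proof.
move=> ThA; have [F [h H]] : exists (F : rcfType) (h : term_model -> F),
    forall b rho f, osat (M := term_model) b rho f <->
      @osat (ring_ostruct F) (h \o b) (h \o rho) f.
  (* [truth] concerns [rho0] only; an axiom has no free variable, so it holds under every
     assignment. *)
  apply: rcof_model_rcf => f Af b rho.
  have lf := rcof_axiom_lc Af; have /(truth b lf) := ThA f Af.
  by apply: (eq_osat lf _ _).1 => // x; rewrite (negPf (rcof_axiom_closed x Af)).
exists F, (h \o (fun=> cls TZero)), (h \o rho0) => f lf.
by rewrite -H truth.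
Qed.

End TermModel.

(** The free variables of [g] are kept as elements of the term model, so an unprovable closure gives
    a point of some real closed field where [g] fails; [qf_transfer] moves it to [R]. *)
Theorem rcof_completeness (R : rcfType) (g : fo) : fqf g -> flc 0 g ->
  (forall b rho, @osat (ring_ostruct R) b rho g) -> rcof_theorem (fo_closure g).
Proof.
move=> qg lg valid; apply: contrapT => nthm.
have con : consistent rcof_axiom [:: FNot g].
  move=> /prv_raa [G AG Gg]; apply: nthm; exists G => //.
  by apply: nd_closure => // h x /AG /rcof_axiom_closed.
have [Th [Th0 Th_con Th_nd Th_cpl Th_all]] := henkin_theory rcof_axiom_closed con.
have [|F [b [rho H]]] := term_model_rcf Th_con Th_nd Th_cpl Th_all.
  by move=> f Af; apply/Th0/prv_ax.
have [b' [rho' /iffRL/(_ (valid _ _))]] := @qf_transfer F R g b rho qg.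
move=> /(H g lg) Thg; apply: Th_con; apply: (Th_nd [:: FNot g; g]).
  by move=> h [<-|[<-|[]]] //; apply/Th0/prv_nd/nd_hyp; left.
by apply: (@nd_impE _ g); apply: nd_hyp; [left|right; left].
Qed.

(** * Quantum structures from classical distributions *)

Section TwoPointMeasure.
Variable R : realType.
Local Open Scope classical_set_scope.
Local Open Scope ring_scope.
Local Notation mR := (measurableTypeR R).

(** The form taken by the vector measures of a projection. It is a bare set function because
    [vector_measure] is one; [two_diracs] is the packaged measure used to integrate. *)
Definition two_point (a b : R) (S : set mR) : \bar R :=
  (a * \1_S (1 : mR) + b * \1_S (0 : mR))%:E.

Definition two_diracs (a b : {nonneg R}) :=
  measure_add (mscale a (dirac (1 : mR))) (mscale b (dirac (0 : mR))).

HB.instance Definition _ a b := Measure.on (two_diracs a b).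

Lemma two_pointE (a b : R) (a0 : 0 <= a) (b0 : 0 <= b) :
  two_point a b = two_diracs (NngNum a0) (NngNum b0).
Proof.
apply: funext => S; rewrite /two_diracs measure_addE /mscale /= /two_point.
by rewrite EFinD !EFinM.
Qed.

Lemma ge0_integral_two_diracs (a b : {nonneg R}) (f : mR -> \bar R) :
  (forall x, 0%E <= f x)%E -> measurable_fun setT f ->
  (\int[two_diracs a b]_x f x = a%:num%:E * f 1%R + b%:num%:E * f 0%R)%E.
Proof.
move=> f0 mf; rewrite ge0_integral_measure_add // !ge0_integral_mscale //=.
by rewrite !integral_dirac // !diracT !mul1e.
Qed.

Lemma integral_two_point_sqr (a b : R) : 0 <= a -> 0 <= b ->
  (\int[two_point a b]_x (x ^+ 2)%:E = a%:E)%E.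
Proof.
move=> a0 b0; rewrite (two_pointE a0 b0) ge0_integral_two_diracs //=.
- by rewrite expr1n expr0n mule1 mule0 adde0.
- by move=> x; rewrite lee_fin sqr_ge0.
- by apply/measurable_EFinP; apply: exprn_measurable.
Qed.

Lemma integral_two_point_id (a b : R) : 0 <= a -> 0 <= b ->
  (\int[two_point a b]_x x%:E = a%:E)%E.
Proof.
move=> a0 b0.
have mf : measurable_fun setT (EFin : mR -> \bar R) by [].
rewrite (two_pointE a0 b0) integralE !ge0_integral_two_diracs //=.
- rewrite !funeposE !funenegE oppe0 maxxx max_l ?lee01 // max_r ?leeN10 //.
  by rewrite mule1 !mule0 !adde0 oppe0 adde0.
- exact: measurable_funeneg.
- exact: measurable_funepos.
Qed.

End TwoPointMeasure.

(** * The observable given by an orthogonal projection *)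

Section ProjectionObservable.
Variables (R : realType) (H : hilbert R).
Local Open Scope classical_set_scope.
Local Open Scope ring_scope.
Local Open Scope complex_scope.
Local Notation mR := (measurableTypeR R).
Implicit Types (x y z : H).

Lemma ipDr x y z : ip x (y + z) = ip x y + ip x z.
Proof. by rewrite -[y]scale1r ip_linr mul1r scale1r. Qed.

Lemma ip0r x : ip x 0 = 0.
Proof. by have := ipDr x 0 0; rewrite addr0 -[LHS]addr0 => /addrI. Qed.

Lemma ipZr x (a : R[i]) y : ip x (a *: y) = a * ip x y.
Proof. by rewrite -[a *: y]addr0 ip_linr ip0r addr0. Qed.

Lemma ipBr x y z : ip x (y - z) = ip x y - ip x z.
Proof. by rewrite ipDr -scaleN1r ipZr mulN1r. Qed.

Lemma ipBl x y z : ip (x - y) z = ip x z - ip y z.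
Proof. by rewrite ip_conj ipBr rmorphB /= -!ip_conj. Qed.

Lemma ip_ge0 x : 0 <= ip x x.
Proof.
by have [->|/ip_gt0/ltW //] := eqVneq x 0; rewrite ip0r.
Qed.

Lemma Re_ip_ge0 x : 0 <= complex.Re (ip x x).
Proof. by have := ip_ge0 x; rewrite lecE => /andP[]. Qed.

Lemma ip_eq0 x : ip x x = 0 -> x = 0.
Proof.
by move=> E; apply/eqP/negPn/negP => /ip_gt0; rewrite E ltxx.
Qed.

Lemma ip_inj y z : (forall x, ip x y = ip x z) -> y = z.
Proof.
by move=> E; apply/eqP; rewrite -subr_eq0; apply/eqP/ip_eq0; rewrite ipBr E subrr.
Qed.

Lemma hnorm0 : hnorm (0 : H) = 0.
Proof. by rewrite /hnorm ip0r sqrtr0. Qed.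

Variable P : H -> H.
Hypothesis Pproj : orth_projection P.

Let Plin a x y : P (a *: x + y) = a *: P x + P y. Proof. by case: Pproj. Qed.
Let Pid x : P (P x) = P x. Proof. by case: Pproj. Qed.
Let Psym x y : ip (P x) y = ip x (P y). Proof. by case: Pproj. Qed.
Let PD x y : P (x + y) = P x + P y.
Proof. by rewrite -[x]scale1r Plin !scale1r. Qed.
Let P0 : P 0 = 0.
Proof. by have := PD 0 0; rewrite addr0 -[LHS]addr0 => /addrI. Qed.
Let PZ a x : P (a *: x) = a *: P x.
Proof. by rewrite -[a *: x]addr0 Plin P0 addr0. Qed.
Let PB x y : P (x - y) = P x - P y.
Proof. by rewrite PD -scaleN1r PZ scaleN1r. Qed.

Let addKB (u v : H) : u + (v - u) = v. Proof. by rewrite addrC subrK. Qed.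

Definition proj_operator : operator H :=
  @Operator R H setT P I (fun _ _ _ _ _ => I) (fun a x y _ _ => Plin a x y).

Lemma proj_operator_sa : self_adjoint proj_operator.
Proof.
split=> [x e e0|y z]; first by exists x => //; rewrite subrr hnorm0.
split=> [A|[_ <-] x _]; last exact: Psym.
by split=> //; apply: ip_inj => x; rewrite -A //= Psym.
Qed.

Let ind (S : set mR) (r : mR) : R[i] := (\1_S r : R)%:C.

(* The spectral measure of a projection sits at 1 and 0. *)
Definition proj_pvm (S : set mR) (x : H) : H :=
  ind S 1 *: P x + ind S 0 *: (x - P x).

Let indE S r : ind S r = (r \in S)%:R.
Proof. by rewrite /ind indicE; case: (r \in S). Qed.

Lemma proj_pvm_lin S a x y :
  proj_pvm S (a *: x + y) = a *: proj_pvm S x + proj_pvm S y.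
Proof.
rewrite /proj_pvm Plin !indE.
case: (_ \in S); case: (_ \in S); rewrite ?scale1r ?scale0r ?add0r ?addr0 ?scaler0 //.
- by rewrite !addKB.
- by rewrite scalerBr opprD addrACA.
Qed.

Lemma proj_pvm_proj S : orth_projection (proj_pvm S).
Proof.
split; first exact: proj_pvm_lin.
  move=> x; rewrite /proj_pvm !indE.
  by case: (_ \in S); case: (_ \in S);
    rewrite ?scale1r ?scale0r ?add0r ?addr0 ?addKB ?PB ?Pid ?subrr ?subr0 ?P0.
move=> x y; rewrite /proj_pvm !indE.
case: (_ \in S); case: (_ \in S); rewrite ?scale1r ?scale0r ?add0r ?addr0.
- by rewrite !addKB.
- exact: Psym.
- by rewrite ipBl ipBr Psym.
- by rewrite ip_conj !ip0r conjc0.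
Qed.

(** By disjointness [r] lies in at most one of the sets, so the partial sums become constant;
    countable additivity of [proj_pvm] then needs no estimate. *)
Lemma indicator_series (F : nat -> set mR) (r : mR) : trivIset setT F ->
  exists N, forall n, (N <= n)%N -> \sum_(k < n) ind (F k) r = ind (\bigcup_n F n) r.
Proof.
move=> tF; have [[k _ Fk]|nF] := pselect ((\bigcup_n F n) r).
  exists k.+1 => n kn; rewrite (bigD1 (Ordinal kn)) //= big1 ?addr0.
    by rewrite !indE mem_set // mem_set //; exists k.
  move=> i ik; rewrite indE memNset // => Fi.
  case/eqP: ik; apply: val_inj => /=; apply: tF => //.
  by exists r.
exists 0%N => n _; rewrite big1 ?indE ?memNset // => i _.
by rewrite indE memNset // => Fi; apply: nF; exists i.
Qed.

Lemma proj_pvmP : pvm proj_pvm.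
Proof.
split=> [S _|x|F mF tF x e e0]; first exact: proj_pvm_proj.
  by rewrite /proj_pvm !indE !in_setT !scale1r addKB.
have [N1 H1] := indicator_series 1 tF; have [N0 H0] := indicator_series 0 tF.
exists (maxn N1 N0) => n; rewrite geq_max => /andP[/H1 E1 /H0 E0].
rewrite /proj_pvm big_split /= -!scaler_suml E1 E0 subrr.
by rewrite hnorm0.
Qed.

Lemma proj_vector_measure x : vector_measure proj_pvm x =
  two_point (complex.Re (ip (P x) (P x))) (complex.Re (ip (x - P x) (x - P x))).
Proof.
apply: funext => S; rewrite /vector_measure /two_point; congr EFin.
have Ei a r : complex.Re (ind S r * a) = complex.Re a * \1_S r.
  by case: a => u v; rewrite /ind /= mul0r subr0 mulrC.
rewrite /proj_pvm [ip x (_ + _)]ipDr !ipZr raddfD /= !Ei; congr (complex.Re _ * _ + complex.Re _ * _).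
  by rewrite Psym Pid.
by rewrite ipBl !ipBr !Psym Pid subrr subr0.
Qed.

Lemma proj_spectral : spectral_measure proj_operator proj_pvm.
Proof.
split; first exact: proj_pvmP.
  move=> x; split=> // _; rewrite proj_vector_measure.
  by rewrite integral_two_point_sqr ?Re_ip_ge0 // ltry.
move=> x _; rewrite proj_vector_measure integral_two_point_id ?Re_ip_ge0 //=.
by rewrite Psym Pid.
Qed.

Definition proj_observable : observable H :=
  @Observable R H proj_operator proj_operator_sa proj_pvm proj_spectral.

Let spec := real_spectrum proj_operator.

(** If 1 is in the resolvent set, [P - 1] is injective, and it kills [P x]. *)
Lemma proj_spectrum1 : ~ spec 1 -> forall x, P x = 0.
Proof.
move=> /contrapT [B [_ _ HB]] x; have B0 := HB 0 I.
rewrite -(HB (P x) I) /= Pid scale1r subrr.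
by rewrite /= P0 scaler0 subrr in B0.
Qed.

Lemma proj_spectrum0 : ~ spec 0 -> forall x, P x = x.
Proof.
move=> /contrapT [B [_ _ HB]] x; have B0 := HB 0 I.
have := HB (x - P x) I; rewrite /= PB Pid subrr scale0r subrr.
rewrite /= P0 scaler0 subrr in B0; rewrite B0 => /esym/eqP.
by rewrite subr_eq0 => /eqP.
Qed.

(** The spectrum lacks 1 when [P] is 0, and a pqv must stay inside the spectrum. The intersection is
    then empty, and its projection is still [P]. *)
Let up : set mR := [set 1] `&` spec.

Lemma measurable_proj_up : measurable up.
Proof.
have [s1|ns1] := pselect (spec 1).
  rewrite (_ : up = [set 1]); first exact: measurable_set1.
  by apply/seteqP; split=> [r []|r -> //].
rewrite (_ : up = set0); first exact: measurable0.
by apply/seteqP; split=> // r [-> /ns1].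
Qed.

Definition proj_pqv : pqv H :=
  @Pqv R H proj_observable up measurable_proj_up (@subIsetr _ _ _).

Lemma proj_pqv_up x : oproj (pobs proj_pqv) (pup proj_pqv) x = P x.
Proof.
rewrite /= /proj_pvm !indE (memNset (u := 0)) ?scale0r ?addr0; last first.
  by move=> [/eqP]; rewrite eq_sym oner_eq0.
have [s1|ns1] := pselect (spec 1); first by rewrite mem_set ?scale1r.
by rewrite proj_spectrum1 // scaler0.
Qed.

Lemma proj_pqv_down x : oproj (pobs proj_pqv) (pdown proj_pqv) x = x - P x.
Proof.
rewrite /= /proj_pvm !indE (memNset (u := 1)) ?scale0r ?add0r; last first.
  by move=> [s1 ns1]; apply: ns1.
have [s0|ns0] := pselect (spec 0); last by rewrite proj_spectrum0 // subrr scaler0.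
rewrite mem_set ?scale1r //; split=> // -[/eqP].
by rewrite eq_sym oner_eq0.
Qed.

End ProjectionObservable.

Lemma real_cauchy_limit (R : realType) (u : nat -> R) :
  (forall e, 0 < e -> exists N, forall m n, (N <= m)%N -> (N <= n)%N ->
     `|u m - u n| < e)%R ->
  exists l, (forall e, 0 < e -> exists N, forall n, (N <= n)%N ->
     `|u n - l| < e)%R.
Proof.
move=> Hu; have cu : cvg (u @ \oo)%classic.
  apply: cauchy_cvg; apply: cauchy_exP => e e0.
  have [N HN] := Hu e e0; exists (u N); exists N => // n /= Nn.
  exact: HN.
exists (limn u) => e e0.
have /cvgrPdist_lt/(_ e e0)[N _ HN] := cu.
by exists N => n Nn; rewrite distrC; apply: HN.
Qed.

(** The cross terms are nonnegative; this bounds the Hilbert norm by the sum of the absolute values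
    of the coordinates. *)
Lemma sum_sqr_le (R : realDomainType) (I : Type) (r : seq I) (F : I -> R) :
  (forall i, 0 <= F i)%R -> (\sum_(i <- r) F i ^+ 2 <= (\sum_(i <- r) F i) ^+ 2)%R.
Proof.
move=> F0; elim: r => [|i r IH]; first by rewrite !big_nil expr0n.
rewrite !big_cons; have S0 : (0 <= \sum_(j <- r) F j)%R by apply: sumr_ge0.
have := mulr_ge0 (F0 i) S0; rewrite sqrrD; lra.
Qed.

(** * Finite-dimensional Hilbert spaces *)

Section FiniteHilbert.
Variables (R : realType) (K : finType).
Local Open Scope classical_set_scope.
Local Open Scope ring_scope.
Local Open Scope complex_scope.

Definition fvec : lmodType R[i] := {ffun K -> R[i]^o}.

Definition fip (x y : fvec) : R[i] := \sum_k (x k)^* * y k.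

Lemma fip_linr x a y z : fip x (a *: y + z) = a * fip x y + fip x z.
Proof.
rewrite /fip mulr_sumr -big_split; apply: eq_bigr => k _ /=.
by rewrite !ffunE mulrDr mulrCA.
Qed.

Lemma fip_conj x y : fip y x = (fip x y)^*.
Proof.
rewrite /fip rmorph_sum; apply: eq_bigr => k _ /=.
by rewrite rmorphM /= conjcK mulrC.
Qed.

Lemma Re_fip x : complex.Re (fip x x) =
  \sum_k (complex.Re (x k) ^+ 2 + complex.Im (x k) ^+ 2).
Proof.
rewrite /fip raddf_sum; apply: eq_bigr => k _.
by case: (x k) => a b /=; rewrite !expr2 mulNr opprK.
Qed.

Lemma fip_ge0 x : 0 <= fip x x.
Proof. by apply: sumr_ge0 => k _; rewrite mulrC; apply: mulcJ_ge0. Qed.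

Lemma fip_gt0 x : x != 0 -> 0 < fip x x.
Proof.
move=> x0; rewrite lt_neqAle fip_ge0 andbT eq_sym; apply: contraNneq x0 => E.
have /eqP : \sum_k (complex.Re (x k) ^+ 2 + complex.Im (x k) ^+ 2) = 0.
  by rewrite -Re_fip E.
rewrite psumr_eq0; last by move=> k _; rewrite addr_ge0 ?sqr_ge0.
move=> /allP H; apply/eqP/ffunP => k; rewrite ffunE.
have := H k (mem_index_enum k); rewrite /= paddr_eq0 ?sqr_ge0 // !sqrf_eq0.
by case: (x k) => a b /= /andP[/eqP -> /eqP ->].
Qed.

Definition fpre : preHilbert R := @PreHilbert R fvec fip fip_linr fip_conj fip_gt0.

Let co (x : fvec) k := `|complex.Re (x k)| + `|complex.Im (x k)|.

Lemma hnorm_le_coords (x : fpre) : hnorm x <= \sum_k co x k.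
Proof.
have S0 : 0 <= \sum_k co x k by apply: sumr_ge0 => k _; rewrite addr_ge0.
rewrite -(ger0_norm S0) -sqrtr_sqr /hnorm ler_wsqrtr // [ip x x]/= Re_fip.
apply: le_trans (sum_sqr_le _ _) => [|k]; last by rewrite addr_ge0.
apply: ler_sum => k _; rewrite sqrrD !real_normK ?num_real //.
have : 0 <= `|complex.Re (x k)| * `|complex.Im (x k)| by rewrite mulr_ge0.
lra.
Qed.

Lemma Re_le_hnorm (x : fpre) k : `|complex.Re ((x : fvec) k)| <= hnorm x.
Proof.
rewrite -sqrtr_sqr /hnorm ler_wsqrtr // [ip x x]/= Re_fip (bigD1 k) //=.
rewrite -addrA lerDl addr_ge0 ?sqr_ge0 // sumr_ge0 // => i _.
by rewrite addr_ge0 ?sqr_ge0.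
Qed.

Lemma Im_le_hnorm (x : fpre) k : `|complex.Im ((x : fvec) k)| <= hnorm x.
Proof.
rewrite -sqrtr_sqr /hnorm ler_wsqrtr // [ip x x]/= Re_fip (bigD1 k) //=.
rewrite addrAC lerDr addr_ge0 ?sqr_ge0 // sumr_ge0 // => i _.
by rewrite addr_ge0 ?sqr_ge0.
Qed.

(** There are twice [#|K|] real coordinates; the added 1 makes the final inequality strict and the
    divisor nonzero for empty [K]. *)
Let small (e : R) : R := e / (2 * #|K|%:R + 1).

Let small_gt0 e : 0 < e -> 0 < small e.
Proof. by move=> e0; rewrite divr_gt0 // ltr_wpDl // mulr_ge0. Qed.

Lemma hnorm_lt_coords (x : fpre) e : 0 < e ->
  (forall k, `|complex.Re ((x : fvec) k)| < small e) ->
  (forall k, `|complex.Im ((x : fvec) k)| < small e) -> hnorm x < e.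
Proof.
move=> e0 HRe HIm; apply: le_lt_trans (hnorm_le_coords x) _.
apply: (@le_lt_trans _ _ (\sum_(k : K) (small e + small e))).
  by apply: ler_sum => k _; rewrite lerD // ltW.
rewrite sumr_const -mulr_natr.
have -> : (small e + small e) * #|K|%:R = (2 * #|K|%:R) * small e.
  by ring.
rewrite /small mulrA ltr_pdivrMr ?ltr_wpDl ?mulr_ge0 //.
by rewrite mulrC mulrDr mulr1 ltrDl.
Qed.

Lemma fpre_complete (u : nat -> fpre) : hcauchy u -> exists l, hcvg u l.
Proof.
move=> Hu.
have Re_lim k : exists l, forall e, 0 < e -> exists N, forall n, (N <= n)%N ->
    `|complex.Re ((u n : fvec) k) - l| < e.
  apply: (@real_cauchy_limit R (fun n => complex.Re ((u n : fvec) k))) => e e0.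
  have [N HN] := Hu e e0; exists N => m n Nm Nn; apply: le_lt_trans (HN m n Nm Nn).
  by apply: le_trans (Re_le_hnorm _ k); rewrite !ffunE raddfB.
have Im_lim k : exists l, forall e, 0 < e -> exists N, forall n, (N <= n)%N ->
    `|complex.Im ((u n : fvec) k) - l| < e.
  apply: (@real_cauchy_limit R (fun n => complex.Im ((u n : fvec) k))) => e e0.
  have [N HN] := Hu e e0; exists N => m n Nm Nn; apply: le_lt_trans (HN m n Nm Nn).
  by apply: le_trans (Im_le_hnorm _ k); rewrite !ffunE raddfB.
have [lr Hlr] := choice Re_lim; have [li Hli] := choice Im_lim.
exists ([ffun k => lr k +i* li k] : fvec) => e e0.
have [Nr HNr] := choice (fun k => Hlr k (small e) (small_gt0 e0)).
have [Ni HNi] := choice (fun k => Hli k (small e) (small_gt0 e0)).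
exists (\max_k maxn (Nr k) (Ni k))%N => n Nn.
have le_n k : (Nr k <= n)%N && (Ni k <= n)%N.
  by rewrite -geq_max (leq_trans _ Nn) // (leq_bigmax k).
apply: hnorm_lt_coords => // k; rewrite !ffunE raddfB /=; have /andP[? ?] := le_n k.
  exact: HNr.
exact: HNi.
Qed.

Lemma fpre_separable : exists2 D : set fpre, countable D & hdense D.
Proof.
pose g (q : {ffun K -> rat * rat}) : fpre :=
  [ffun k => ratr (q k).1 +i* ratr (q k).2] : fvec.
exists (range g).
  by apply: card_le_trans (card_image_le _ _) _; apply: countableP.
move=> x e e0.
have rat_near (a : R) : exists q : rat, `|a - ratr q| < small e.
  have [|q] := @rat_in_itvoo R (a - small e) (a + small e).
    by have := small_gt0 e0; lra.
  rewrite in_itv /= => /andP[h1 h2]; exists q; rewrite ltr_norml.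
  by apply/andP; split; lra.
have [qr Hqr] := choice (fun k => rat_near (complex.Re ((x : fvec) k))).
have [qi Hqi] := choice (fun k => rat_near (complex.Im ((x : fvec) k))).
exists (g [ffun k => (qr k, qi k)]); first by exists [ffun k => (qr k, qi k)].
by apply: hnorm_lt_coords => // k; rewrite !ffunE raddfB /=.
Qed.

Definition fhilbert : hilbert R := @Hilbert R fpre fpre_complete fpre_separable.

End FiniteHilbert.

Lemma cardfs2P (A : {fset nat}) :
  reflect (exists i j, i != j /\ A = [fset i; j]%fset) (#|` A| == 2)%fset.
Proof.
apply: (iffP eqP) => [|[i [j [ij ->]]]]; last by rewrite cardfs2 ij.
have uA := fset_uniq A; case E: (enum_fset A) uA => [|i [|j [|k s]]] //=.
rewrite inE andbT => ij _; exists i, j; split=> //; apply/fsetP => x.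
by rewrite !inE -[x \in A]/(x \in enum_fset A) E !inE.
Qed.

(** * The quantum structure of a solution of the translation *)

Section ClassicalModel.
Variables (R : realType) (A : {fset nat}) (mu : rvar -> R).
Local Open Scope fset_scope.
Local Open Scope ring_scope.
Local Open Scope complex_scope.

Let prob (U : {fset nat}) : R := mu (VForm (cphi A U)).

Hypothesis prob_ge0 : forall U, U `<=` A -> 0 <= prob U.
Hypothesis prob_sum : \sum_(U <- fpowerset A) prob U = 1.

(** Ordering the indices gives each unordered pair one active block and fixes which of its two
    symbols gets which projection. *)
Let incompat (ab : A * A) : bool :=
  (val ab.1 < val ab.2)%N && (mu (VPair [fset val ab.1; val ab.2]) != 0).

Let K : finType := (fpowerset A + (A * A) * bool)%type.
Let V := fvec R K.
Let H := fhilbert R K.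

(* On the first summand the projections are classical events; a block C^2 for
   each incompatible pair carries |0><0| and |+><+|, which do not commute. *)
Definition event_proj (j : nat) (x : V) : V :=
  [ffun k : K => match k with
    | inl U => if j \in val U then (x k : R[i]) else (0 : R[i])
    | inr (ab, c) =>
        if incompat ab then
          if j == val ab.1 then (if c then (x k : R[i]) else (0 : R[i]))
          else if j == val ab.2 then (x (inr (ab, true)) + x (inr (ab, false))) / 2
          else (0 : R[i])
        else (0 : R[i])
    end].

Lemma event_projP j : @orth_projection R H (event_proj j).
Proof.
split=> [a x y|x|x y].
- apply/ffunP => -[U|[ab c]]; rewrite !ffunE.
    by case: ifP; rewrite ?scaler0 ?addr0.
  case: ifP; rewrite ?scaler0 ?addr0 // => _.
  case: ifP; rewrite ?scaler0 ?addr0 // => _.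
    by case: c; rewrite ?scaler0 ?addr0.
  case: ifP; rewrite ?scaler0 ?addr0 // => _.
  by rewrite /GRing.scale /=; ring.
- apply/ffunP => -[U|[ab c]]; rewrite !ffunE; first by case: (j \in val U).
  case: ifP => // iab; case: ifP => ja; first by case: c; rewrite ?iab ?ja.
  by case: ifP => // jb; rewrite ?iab ?ja ?jb; field.
- rewrite /= /fip !big_sumType /=; congr (_ + _).
    apply: eq_bigr => U _; rewrite !ffunE.
    by case: ifP; rewrite ?rmorph0 ?mul0r ?mulr0.
  pose Fl ab c := (event_proj j x (inr (ab, c)))^* * y (inr (ab, c)).
  pose Fr ab c := (x (inr (ab, c)))^* * event_proj j y (inr (ab, c)).
  have -> : \sum_i (event_proj j x (inr i))^* * y (inr i) = \sum_i Fl i.1 i.2.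
    by apply: eq_bigr => -[].
  have -> : \sum_i (x (inr i))^* * event_proj j y (inr i) = \sum_i Fr i.1 i.2.
    by apply: eq_bigr => -[].
  rewrite -!(pair_big xpredT xpredT) /=; apply: eq_bigr => ab _.
  rewrite !big_bool /Fl /Fr !ffunE.
  case: ifP; rewrite ?rmorph0 ?mul0r ?mulr0 // => _.
  case: ifP; rewrite ?rmorph0 ?mul0r ?mulr0 // => _.
  case: ifP; rewrite ?rmorph0 ?mul0r ?mulr0 // => _.
  by rewrite rmorphM rmorphD fmorphV rmorph_nat /=; ring.
Qed.

(** In an active block at least one of the two projections is 0, since [i] and [j] cannot be its two
    symbols; on the classical summand both only erase coordinates. *)
Lemma event_proj_comm i j : (i != j -> mu (VPair [fset i; j]) = 0) ->
  forall x, event_proj i (event_proj j x) = event_proj j (event_proj i x).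
Proof.
move=> Hij x; have [-> //|ij] := eqVneq i j.
have {}Hij := Hij ij.
apply/ffunP => -[U|[ab c]]; rewrite !ffunE; first by case: (i \in val U); case: (j \in val U).
case: (boolP (incompat ab)) => [/andP[lab nab]|//].
have [ia|ia] := eqVneq i (val ab.1).
  have -> : (j == val ab.1) = false by rewrite -ia eq_sym (negPf ij).
  have -> : (j == val ab.2) = false.
    by apply/eqP => jb; rewrite -ia -jb Hij eqxx in nab.
  by case: c => //=; rewrite addr0 mul0r.
have [ib|ib] := eqVneq i (val ab.2).
  have -> : (j == val ab.2) = false by rewrite -ib eq_sym (negPf ij).
  have -> : (j == val ab.1) = false.
    by apply/eqP => jb; rewrite -ib -jb fsetUC Hij eqxx in nab.
  by rewrite addr0 mul0r.
by do ?case: ifP => //; rewrite ?addr0 ?mul0r.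
Qed.

Lemma event_proj_comm_pair (i j : A) : (val i < val j)%N ->
  (forall x, event_proj (val i) (event_proj (val j) x) =
             event_proj (val j) (event_proj (val i) x)) ->
  mu (VPair [fset val i; val j]) = 0.
Proof.
move=> lij comm; apply/eqP/negPn/negP => nij.
have ij : (val j == val i) = false by apply/eqP => E; rewrite E ltnn in lij.
(* The basis vector [true] of the block. At [false], applying the projection of [i] last leaves 0,
   while applying that of [j] last leaves one half. *)
pose x : V := [ffun k => if k == inr ((i, j), true) then 1 else 0].
have := congr1 (fun z : V => z (inr ((i, j), false))) (comm x).
rewrite !ffunE /incompat /= lij nij /= !eqxx ij /= addr0 => /eqP.
by rewrite eq_sym mulf_eq0 invr_eq0 pnatr_eq0 oner_eq0.
Qed.

(** Amplitudes are square roots of probabilities, as in the Born rule; being 0 on the blocks hides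
    the non-commuting parts from all joint probabilities. *)
Definition event_state : V :=
  [ffun k : K => if k is inl U then (Num.sqrt (prob (val U)))%:C else (0 : R[i])].

Lemma prob_val_ge0 (U : fpowerset A) : 0 <= prob (val U).
Proof. by apply: prob_ge0; rewrite -fpowersetE; apply: valP. Qed.

Lemma event_state_unit : hnorm (event_state : H) = 1.
Proof.
rewrite /hnorm [ip _ _]/= Re_fip big_sumType /= [X in _ + X]big1 ?addr0; last first.
  by move=> i _; rewrite !ffunE /= expr0n addr0.
rewrite (eq_bigr (fun U : fpowerset A => prob (val U))); last first.
  by move=> U _; rewrite !ffunE /= expr0n addr0 sqr_sqrtr // prob_val_ge0.
by rewrite -(big_seq_fsetE _ _ xpredT) prob_sum sqrtr1.
Qed.

Definition event_struct : qstruct R :=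
  @Qstruct R H event_state event_state_unit (fun j => proj_pqv (event_projP j)).

Lemma event_up j x : oproj (pobs (qpqv event_struct j)) (pup (qpqv event_struct j)) x =
  event_proj j x.
Proof. exact: (proj_pqv_up (event_projP j)). Qed.

Lemma event_down j x : oproj (pobs (qpqv event_struct j)) (pdown (qpqv event_struct j)) x =
  (x - event_proj j x : V).
Proof. exact: (proj_pqv_down (event_projP j)). Qed.

Lemma event_compatible i j :
  compatible (qpqv event_struct i) (qpqv event_struct j) <->
  forall x, event_proj i (event_proj j x) = event_proj j (event_proj i x).
Proof.
by split=> C x; have := C x; rewrite 4!event_up.
Qed.

Lemma event_observable a : csyms a `<=` A ->
  qobservable event_struct a <->
  (forall A', A' \in fpairs (esyms a) -> mu (VPair A') = 0).
Proof.
move=> aA; have eA i : i \in esyms a -> i \in A.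
  by rewrite !inE /= => /andP[ia _]; apply: (fsubsetP aA).
split=> [obs A'|pairs i j ie je].
  rewrite mem_filter => /andP[/cardfs2P[i [j [ij ->]]]].
  rewrite fpowersetE fsubUset !fsub1set => /andP[ie je].
  wlog lij : i j ij ie je / (i < j)%N => [W|].
    move: (ij); rewrite neq_ltn => /orP[lij|lji]; first exact: W.
    by rewrite fsetUC; apply: W => //; rewrite eq_sym.
  apply: (@event_proj_comm_pair [` eA i ie] [` eA j je]) => //.
  exact/event_compatible/obs.
apply/event_compatible/event_proj_comm => ij; apply: pairs.
rewrite mem_filter cardfs2 ij fpowersetE fsubUset !fsub1set.
by rewrite ie je.
Qed.

Definition event_measure (w : nat -> bool) (x : V) (j : nat) : V :=
  if w j then event_proj j x else x - event_proj j x.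

Lemma event_measureE w x j :
  oproj (pobs (qpqv event_struct j)) (outcome event_struct w j) x =
  event_measure w x j.
Proof.
by rewrite /outcome /event_measure; case: (w j); rewrite ?event_up ?event_down.
Qed.

(** On the classical summand each outcome erases the sets that contradict it, and a block that
    starts at 0 stays at 0. *)
Lemma event_foldl w s (x : V) : (forall i, x (inr i) = 0) ->
  (forall i, foldl (event_measure w) x s (inr i) = 0) /\
  (forall U, foldl (event_measure w) x s (inl U) =
     if all (fun j => (j \in val U) == w j) s then x (inl U) else 0).
Proof.
elim: s x => [|j s IH] x x0 //=; set z := event_measure w x j.
have z0 i : z (inr i) = 0.
  case: i => ab c; rewrite /z /event_measure; case: (w j); rewrite !ffunE !x0.
    by do ?case: ifP => //; rewrite addr0 mul0r.
  by do ?case: ifP => //; rewrite ?addr0 ?mul0r subr0.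
have [y0 yE] := IH z z0; split=> // U; rewrite yE /z /event_measure.
case: (w j); rewrite !ffunE; case: (j \in val U) => //=;
  by rewrite ?subrr ?subr0 //; case: ifP.
Qed.

Lemma event_amplitude w s : joint_amplitude event_struct w s =
  (\sum_(U <- fpowerset A | all (fun j => (j \in U) == w j) s) prob U)%:C.
Proof.
have st0 i : event_state (inr i) = 0 by rewrite ffunE.
have [y0 yE] := event_foldl w s st0.
have -> : joint_amplitude event_struct w s =
    fip event_state (foldl (event_measure w) event_state s).
  rewrite /joint_amplitude -[LHS]/(fip event_state _); congr (fip _ _).
  rewrite [qstate _]/=; move: event_state => x; elim: s x {y0 yE} => [//|j s IH] x.
  rewrite -[RHS]/(foldl (event_measure w) (event_measure w x j) s).
  by rewrite -event_measureE; apply: IH.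
rewrite /fip big_sumType /= [X in _ + X]big1 ?addr0; last first.
  by move=> i _; rewrite st0 rmorph0 mul0r.
rewrite rmorph_sum /= big_seq_fsetE [RHS]big_mkcond /=; apply: eq_bigr => U _.
rewrite yE; case: ifP => _; last by rewrite mulr0.
rewrite -[prob (val U)]sqr_sqrtr ?prob_val_ge0 // expr2 rmorphM !ffunE.
by congr (_ * _); apply: conjc_real.
Qed.

Lemma csyms_event (B U : {fset nat}) (v : {ffun B -> bool}) :
  all (fun j => (j \in U) == vext v j) (sort leq B) = (U `&` B == vtrue v).
Proof.
apply/allP/eqP => [E|E j]; last first.
  rewrite mem_sort => jB; move/fsetP/(_ j): E.
  by rewrite !inE /= jB andbT => ->.
apply/fsetP => j; rewrite !inE /=; have [jB|//] := boolP (j \in B); last by rewrite andbF.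
by rewrite andbT; apply/eqP/E; rewrite mem_sort.
Qed.

Hypothesis prob_marginal : forall A' U', A' `<=` A -> U' `<=` A' ->
  mu (VForm (cphi A' U')) = \sum_(U <- fpowerset A | U `&` A' == U') prob U.

(** The amplitude for [v] adds up the sets [U] whose trace on the symbols of [a] is [vtrue v], which
    is the marginal condition. *)
Lemma event_prob a : csyms a `<=` A ->
  mu (VForm a) = \sum_(v : {ffun csyms a -> bool} | csat (vext v) a)
      mu (VForm (cphi (csyms a) (vtrue v))) ->
  qprob event_struct a = mu (VForm a).
Proof.
move=> aA ->; rewrite /qprob raddf_sum; apply: eq_bigr => v _.
rewrite event_amplitude /= prob_marginal //; last first.
  by apply/fsubsetP => j; rewrite !inE => /andP[].
by apply: eq_bigl => U; rewrite csyms_event.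
Qed.

End ClassicalModel.

(** * The translation and weak completeness *)

Lemma In_map (T : eqType) (U : Type) (g : T -> U) (s : seq T) x :
  x \in s -> List.In (g x) (map g s).
Proof.
elim: s => //= y s IH; rewrite inE => /predU1P[->|/IH]; [by left|by right].
Qed.

Lemma In_allpairs (S T : eqType) (U : Type) (g : S -> T -> U) s (t : S -> seq T) x y :
  x \in s -> y \in t x -> List.In (g x y) [seq g x y | x <- s, y <- t x].
Proof.
move=> + yt; elim: s => //= z s IH; rewrite inE In_cat.
by move=> /predU1P[E|/IH]; [left; rewrite -E; apply: In_map|right].
Qed.

Lemma osat_fconj (M : ostruct) (b : nat -> M) rho fs :
  osat b rho (fconj fs) <-> (forall f, List.In f fs -> osat b rho f).
Proof.
case: fs => [|f fs]; first by split=> [_ f []|_ /=].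
rewrite /fconj /seqop; elim: fs f => [|g fs IH] f.
  by split=> [ff h [<-|[]]|H] //; apply: H; left.
rewrite [foldl _ _ _]/= IH; split=> H.
  have /osat_FAnd[Hf Hg] := H (FAnd f g) (or_introl erefl).
  by move=> h [<-|[<-|hfs]] //; apply: H; right.
move=> h [<-|hfs]; last by apply: H; right; right.
by apply/osat_FAnd; split; apply: H; [left|right; left].
Qed.

Lemma otval_fsum (F : numDomainType) (e : nat + rvar -> F) ts :
  @otval (ring_ostruct F) _ e (fsum ts) =
  (\sum_(t <- ts) @otval (ring_ostruct F) _ e t)%R.
Proof.
case: ts => [|t ts]; first by rewrite big_nil.
rewrite /fsum /seqop; elim: ts t => [|u ts IH] t; first by rewrite /= big_seq1.
by rewrite [foldl _ _ _]/= IH !big_cons addrA.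
Qed.

(** The two syntactic conditions of [rcof_completeness]. *)
Definition fok (f : fo) : bool := fqf f && flc 0 f.

Lemma fok_FImp f g : fok f -> fok g -> fok (FImp f g).
Proof. by rewrite /fok /= => /andP[-> ->] /andP[-> ->]. Qed.

Lemma fok_FAnd f g : fok f -> fok g -> fok (FAnd f g).
Proof. by move=> ff fg; do !apply: fok_FImp. Qed.

Lemma fok_fconj fs : all fok fs -> fok (fconj fs).
Proof.
case: fs => //= f fs; elim: fs f => [|g fs IH] f /=; first by rewrite andbT.
by move=> /and3P[ff fg fs']; apply: IH; rewrite fs' fok_FAnd.
Qed.

Lemma tlc_fsum ts : all (tlc 0) ts -> tlc 0 (fsum ts).
Proof.
case: ts => //= t ts; elim: ts t => [|u ts IH] t /=; first by rewrite andbT.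
by move=> /and3P[lt lu ts']; apply: IH; rewrite ts' andbT /tlc /= all_cat; apply/andP.
Qed.

Lemma tlc_fsum_map (T : Type) (g : T -> cform) s :
  tlc 0 (fsum [seq xform (g x) | x <- s]).
Proof. by apply: tlc_fsum; elim: s. Qed.

Lemma all_map_true (T U : Type) (p : pred U) (g : T -> U) s :
  (forall x, p (g x)) -> all p (map g s).
Proof. by move=> H; elim: s => //= x s ->; rewrite H. Qed.

Lemma all_allpairs_true (S T U : Type) (p : pred U) (g : S -> T -> U) s
    (t : S -> seq T) :
  (forall x y, p (g x y)) -> all p [seq g x y | x <- s, y <- t x].
Proof.
by move=> H; elim: s => //= x s IH; rewrite all_cat IH andbT all_map_true.
Qed.

Lemma fok_FEq s t : tlc 0 s -> tlc 0 t -> fok (FEq s t).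
Proof. by rewrite /fok /= => -> ->. Qed.

Lemma fok_FLe s t : tlc 0 s -> tlc 0 t -> fok (FLe s t).
Proof. by rewrite /fok /= => -> ->. Qed.

Lemma fok_QAD A Delta : fok (QAD A Delta).
Proof.
apply: fok_fconj; rewrite !all_cat /= andbT; apply/and5P; split.
- by apply: all_map_true => U; apply: fok_FAnd; apply: fok_FLe.
- by apply: fok_FEq => //; apply: tlc_fsum_map.
- by apply: all_allpairs_true => A' U'; apply: fok_FEq => //; apply: tlc_fsum_map.
- by apply: all_map_true => A'; apply: fok_FLe.
- apply: all_map_true => a; apply: fok_FEq => //.
  exact: (tlc_fsum_map (fun v => cphi (csyms a) (vtrue v))).
Qed.

Lemma fok_QO A : fok (QO A).
Proof. by apply: fok_fconj; apply: all_map_true => A'; apply: fok_FEq. Qed.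

Lemma fok_rcof f : fok (rcof f).
Proof.
elim: f => [a|a c p|g IHg h IHh] /=; first exact: fok_QO.
  apply: fok_FAnd (fok_QO _) _.
  have lp : tlc 0 (tmap (fun k : nat => inr (VNum k)) p).
    by rewrite /tlc tvars_tmap all_map; apply/allP.
  by case: c; rewrite /fok /= lp.
exact: fok_FImp.
Qed.

(** * Real solutions of the translation *)

Section Satisfaction.
Variables (R : realType) (A : {fset nat}) (Delta : seq cform).
Variables (b : nat -> R) (mu : rvar -> R).
Local Open Scope ring_scope.
Local Open Scope fset_scope.
Hypothesis HQ : @osat (ring_ostruct R) b mu (QAD A Delta).

Let parts := (osat_fconj (M := ring_ostruct R) b mu _).1 HQ.

Let osat_FLe s t : @osat (ring_ostruct R) b mu (FLe s t) ->
  teval (oenv b mu) s <= teval (oenv b mu) t.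
Proof. by move=> /osat_FOr; rewrite /= !otval_ring => -[/ltW|->]. Qed.

Lemma QAD_ge0 U : U `<=` A -> 0 <= mu (VForm (cphi A U)).
Proof.
move=> UA; suff /osat_FAnd[/osat_FLe //] : @osat (ring_ostruct R) b mu
    (FAnd (FLe TZero (xform (cphi A U))) (FLe (xform (cphi A U)) TOne)) by [].
apply: parts; apply/In_cat; left.
by apply: (In_map (fun U => FAnd (FLe TZero (xform (cphi A U)))
  (FLe (xform (cphi A U)) TOne))); rewrite fpowersetE.
Qed.

Lemma QAD_sum : \sum_(U <- fpowerset A) mu (VForm (cphi A U)) = 1.
Proof.
have /= : @osat (ring_ostruct R) b mu
    (FEq (fsum [seq xform (cphi A U) | U <- fsubsets A]) TOne).
  by apply: parts; rewrite !In_cat; right; left; left.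
by rewrite otval_fsum big_map.
Qed.

Lemma QAD_marginal A' U' : A' `<=` A -> U' `<=` A' ->
  mu (VForm (cphi A' U')) =
  \sum_(U <- fpowerset A | U `&` A' == U') mu (VForm (cphi A U)).
Proof.
move=> AA' UA'; have /= : @osat (ring_ostruct R) b mu
    (FEq (xform (cphi A' U'))
      (fsum [seq xform (cphi A U) | U <- fsubsets A & U `&` A' == U'])).
  apply: parts; rewrite !In_cat; right; right; left.
  by apply: (In_allpairs (fun A' U' => FEq (xform (cphi A' U'))
      (fsum [seq xform (cphi A U) | U <- fsubsets A & U `&` A' == U'])));
    rewrite fpowersetE.
by rewrite otval_fsum big_map big_filter.
Qed.

Lemma QAD_form a : a \in Delta ->
  mu (VForm a) = \sum_(v : {ffun csyms a -> bool} | csat (vext v) a)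
      mu (VForm (cphi (csyms a) (vtrue v))).
Proof.
move=> aD; have /= : @osat (ring_ostruct R) b mu (FEq (xform a)
    (fsum [seq xform (cphi (csyms a) (vtrue v))
      | v : {ffun csyms a -> bool} <- enum {: {ffun csyms a -> bool}}
      & csat (vext v) a])).
  apply: parts; rewrite !In_cat; do 4!right.
  exact: (In_map (fun a => FEq (xform a)
    (fsum [seq xform (cphi (csyms a) (vtrue v))
      | v : {ffun csyms a -> bool} <- enum {: {ffun csyms a -> bool}}
      & csat (vext v) a]))).
by rewrite otval_fsum big_map big_filter big_enum_cond.
Qed.

(** [CTop] is the formula [cphi fset0 fset0], and the marginal equation for the empty set equates
    its variable with the total mass 1. *)
Lemma QAD_top : ~ @osat (ring_ostruct R) b mu (rcof PFalse).
Proof.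
move=> /osat_FAnd[_ /=]; suff -> : mu (VForm CTop) = 1 by rewrite ltxx.
have := @QAD_marginal fset0 fset0 (fsub0set _) (fsub0set _).
rewrite /cphi eqxx => ->; rewrite -[RHS]QAD_sum; apply: eq_bigl => U.
by rewrite fsetI0 eqxx.
Qed.

Let I := event_struct QAD_ge0 QAD_sum.

(** [Delta] has to contain the integrated formulas, because only their variables are tied by [QAD]
    to the distribution. *)
Lemma rcof_sat f : psyms f `<=` A -> {subset pints f <= Delta} ->
  psat I (fun k => mu (VNum k)) f <-> @osat (ring_ostruct R) b mu (rcof f).
Proof.
have obs a : csyms a `<=` A ->
    qobservable I a <-> @osat (ring_ostruct R) b mu (QO (esyms a)).
  move=> aA; rewrite (event_observable QAD_ge0 QAD_sum aA) osat_fconj.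
  split=> H => [g|A' AE].
    move=> /List.in_map_iff [A' [<- AE]]; apply: (H A').
    by elim: (fpairs _) AE => //= B s IH [->|/IH]; rewrite inE ?eqxx // => ->; rewrite orbT.
  have := H _ (In_map (fun A' => FEq (xpair A') TZero) AE).
  by [].
have tE p : @otval (ring_ostruct R) _ (oenv b mu) (tmap (fun k => inr (VNum k)) p) =
    teval (fun k => mu (VNum k)) p.
  by rewrite otval_tbind -otval_ring; apply: eq_in_otval.
elim: f => [a|a c p|g IHg h IHh].
- by move=> aA _; apply: obs.
- move=> aA aD; have aE : qprob I a = mu (VForm a).
    by apply: (event_prob QAD_ge0 QAD_sum QAD_marginal aA);
      apply: QAD_form; apply: aD; rewrite mem_head.
  pose cmp_sat (x y : R) : Prop := if c is CEq then x = y else x < y.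
  have cE : @osat (ring_ostruct R) b mu
      (fcmp c (xform a) (tmap (fun k => inr (VNum k)) p)) <->
      cmp_sat (qprob I a) (teval (fun k => mu (VNum k)) p).
    by rewrite aE /cmp_sat -tE; case: (c).
  have -> : psat I (fun k => mu (VNum k)) (PInt a c p) =
      (qobservable I a /\ cmp_sat (qprob I a) (teval (fun k => mu (VNum k)) p)).
    by rewrite /cmp_sat; case: (c).
  have H := osat_FAnd (M := ring_ostruct R) b mu (QO (esyms a))
    (fcmp c (xform a) (tmap (fun k => inr (VNum k)) p)).
  by rewrite (obs a aA) -cE; apply: iff_sym; apply: H.
rewrite [psyms _]/= fsubUset [pints _]/= => /andP[gA hA] sub.
rewrite -[psat I _ _]/(psat I _ g -> psat I _ h) [rcof _]/= osat_FImp IHg ?IHh //.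
  by move=> a ag; apply: sub; rewrite mem_cat ag orbT.
by move=> a ag; apply: sub; rewrite mem_cat ag.
Qed.

End Satisfaction.

(** * Propositional reasoning over literals *)

Fixpoint patoms (f : pform) : seq pform :=
  if f is PImp g h then patoms g ++ patoms h else [:: f].

Lemma patoms_atomic f a : List.In a (patoms f) -> patomic a.
Proof.
by elim: f => [c|c o p|g IHg h IHh] /=; [case=> [<-|]|case=> [<-|]|rewrite In_cat => -[]].
Qed.

Lemma peval_atomic w a : patomic a -> peval w a = w a.
Proof. by case: a. Qed.

Definition literals (s : seq pform) (bs : seq bool) : seq pform :=
  [seq if ab.2 then ab.1 else PNot ab.1 | ab <- zip s bs].

Lemma literals_literal s bs c : (forall a, List.In a s -> patomic a) ->
  List.In c (literals s bs) -> pliteral c.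
Proof.
elim: s bs => [|a s IH] [|b bs] //= Hs [<-|]; last first.
  by apply: IH => a' a's; apply: Hs; right.
have pa : patomic a by apply: Hs; left.
by case: b; [left|right; exists a].
Qed.

Lemma In_literals s (w : pform -> bool) a : List.In a s ->
  List.In (if w a then a else PNot a) (literals s (map w s)).
Proof. by elim: s => //= a' s IH [->|/IH ?]; [left|right]. Qed.

Lemma peval_literals w s : (forall a, List.In a s -> patomic a) ->
  w PFalse = false -> all (peval w) (literals s (map w s)).
Proof.
move=> + wF; elim: s => //= a s IH Hs; rewrite IH ?andbT; last first.
  by move=> a' a's; apply: Hs; right.
have /(peval_atomic w) pa : patomic a by apply: Hs; left.
by case E: (w a); rewrite /= pa E.
Qed.

Lemma peval_foldl w b1 bs : w PFalse = false ->
  peval w (foldl PAnd b1 bs) = peval w b1 && all (peval w) bs.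
Proof.
move=> wF; elim: bs b1 => [|c bs IH] b1 /=; first by rewrite andbT.
by rewrite IH /= wF; case: (peval w b1); case: (peval w c).
Qed.

Lemma psyms_foldl b1 bs c : List.In c (b1 :: bs) ->
  (psyms c `<=` psyms (foldl PAnd b1 bs))%fset /\
  {subset pints c <= pints (foldl PAnd b1 bs)}.
Proof.
elim: bs b1 c => [|d bs IH] b1 c; first by case=> [<-|[]]; split=> //; apply: fsubset_refl.
have [H1 H2] := IH (PAnd b1 d) (PAnd b1 d) (or_introl erefl).
move=> [<-|[<-|cbs]] /=; last by apply: IH; right.
  split; first by apply: fsubset_trans H1 => /=; rewrite -fsetUA fsubsetUl.
  by move=> a ab; apply: H2; rewrite /= !mem_cat ab.
split; first by apply: fsubset_trans H1; apply/fsubsetP => x xd; rewrite !inE xd !orbT.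
by move=> a ab; apply: H2; rewrite /= !mem_cat ab !orbT.
Qed.

Lemma psat_peval (R : realType) (I : qstruct R) rho (w : pform -> bool) f :
  (forall a, List.In a (patoms f) -> psat I rho a <-> w a) ->
  psat I rho f <-> peval w f.
Proof.
elim: f => [c|c o p|g IHg h IHh] H; [by apply: H; left|by apply: H; left|].
have {}IHg : psat I rho g <-> peval w g.
  by apply: IHg => a ag; apply: H; apply/In_cat; left.
have {}IHh : psat I rho h <-> peval w h.
  by apply: IHh => a ag; apply: H; apply/In_cat; right.
rewrite -[psat I rho _]/(psat I rho g -> psat I rho h) /= IHg IHh.
by split=> [H'|/implyP //]; apply/implyP.
Qed.

(** The translated statement is quantifier-free, so by [rcof_completeness] the proviso of RR may be
    checked at real points alone. *)
Lemma rr_from_validity (R : realType) b1 bs b :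
  (forall c, List.In c (b1 :: bs) -> pliteral c) -> pliteral b ->
  (forall v mu, let f := rr_formula b1 bs b in
     @osat (ring_ostruct R) v mu (QAD (psyms f) (undup (pints f))) ->
     (forall c, List.In c (b1 :: bs) -> @osat (ring_ostruct R) v mu (rcof c)) ->
     @osat (ring_ostruct R) v mu (rcof b)) ->
  plqo_derivable (rr_formula b1 bs b).
Proof.
move=> lbs lb H; apply: RR => //; rewrite /rr_proviso.
set g := FImp _ _.
have /andP[qg lg] : fok g.
  apply: fok_FImp (fok_rcof _); apply: fok_FAnd; first exact: fok_QAD.
  by apply: fok_fconj; apply: all_map_true => c; apply: fok_rcof.
apply: (@rcof_completeness R) => // v mu.
rewrite /g osat_FImp osat_FAnd osat_fconj => -[HQ Hbs]; apply: H => // c cbs.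
apply: Hbs; exact: (List.in_map rcof _ _ cbs).
Qed.

(** Ex falso for atoms: RR applies because [QAD] refutes the translation of [PFalse]. *)
Lemma pfalse_derives (R : realType) a : patomic a -> plqo_derivable (PImp PFalse a).
Proof.
move=> pa; apply: (@rr_from_validity R PFalse [::] a).
- by move=> c [<-|[]]; left.
- by left.
- move=> v mu f HQ H; case: (QAD_top HQ).
  by apply: H; left.
Qed.

(** A real solution of the translated literals would give a structure in which the atoms of [f] have
    the truth values of [w], so that the valid [f] would fail. The premise [PNot PFalse] supplies
    the head that [rr_formula] requires. *)
Lemma countermodel_derives (R : realType) f w : plqo_valid R f ->
  w PFalse = false -> ~~ peval w f ->
  plqo_derivable (rr_formula (PNot PFalse) (literals (patoms f) (map w (patoms f))) PFalse).
Proof.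
move=> valid wF nf; set ls := literals _ _.
have atomic a : List.In a (patoms f) -> patomic a by apply: patoms_atomic.
apply: (@rr_from_validity R).
- move=> c [<-|]; first by right; exists PFalse.
  exact: literals_literal.
- by left.
move=> v mu F HQ Hls; apply: contrapT => nF; case/negP: nf.
have F_lit c : List.In c ls -> (psyms c `<=` psyms F)%fset /\ {subset pints c <= undup (pints F)}.
  move=> cls; have [s1 s2] := psyms_foldl (or_intror (PNot PFalse = c) cls).
  split; first by apply: fsubset_trans s1 _; apply: fsubsetUl.
  by move=> a /s2 ac; rewrite mem_undup mem_cat ac.
apply: (psat_peval (I := event_struct (QAD_ge0 HQ) (QAD_sum HQ))
  (rho := fun k => mu (VNum k)) _).1 (valid _ _) => a af.
have al := In_literals w af; have [s1 s2] := F_lit _ al.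
have := Hls _ (or_intror al).
have [sa sa'] : (psyms a `<=` psyms F)%fset /\ {subset pints a <= undup (pints F)}.
  move: s1 s2; case: (w a) => //=; rewrite fsetU0 => ? s2; split=> // c ca.
  by apply: s2; rewrite mem_cat ca.
rewrite (rcof_sat HQ sa sa'); case: (w a) => [? //|/= H].
by split=> // /H.
Qed.

Lemma peval_foldr w f hs : peval w (foldr PImp f hs) = all (peval w) hs ==> peval w f.
Proof. by elim: hs => //= h hs ->; case: (peval w h). Qed.

Lemma derivable_from hs f : (forall h, List.In h hs -> plqo_derivable h) ->
  ptautology (foldr PImp f hs) -> plqo_derivable f.
Proof.
move=> Hhs /TT; elim: hs Hhs => //= h hs IH Hhs D; apply: IH.
  by move=> h' ?; apply: Hhs; right.
by apply: MP D; apply: Hhs; left.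
Qed.

Lemma peval_all_atoms (w : pform -> bool) f : (forall a, List.In a (patoms f) -> w a) -> peval w f.
Proof.
elim: f => [c|c o p|g IHg h IHh] /= H; [by apply: H; left|by apply: H; left|].
by rewrite IHh ?implybT // => a ah; apply: H; apply/In_cat; right.
Qed.

Lemma all_In (T : Type) (p : pred T) s x : all p s -> List.In x s -> p x.
Proof. by elim: s => //= y s IH /andP[py ps] [<-|/IH]; auto. Qed.

(** A valuation matters only through its values on the atoms of [f], so finitely many derivable
    formulas, one for each list of truth values, have [f] as a tautological consequence once ex
    falso for its atoms is added. *)
Theorem mainTheorem6 (R : realType) (f : pform) : plqo_valid R f -> plqo_derivable f.
Proof.
move=> valid; pose m := size (patoms f).
have [|H HH] := @choice (seq bool) pform (fun bs h => plqo_derivable h /\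
    forall w : pform -> bool, w PFalse = false -> map w (patoms f) = bs ->
      ~~ peval w f -> ~~ peval w h).
  move=> bs.
  have [[w [wF wbs nf]]|nw] := pselect (exists w,
      [/\ w PFalse = false, map w (patoms f) = bs & ~~ peval w f]).
    exists (rr_formula (PNot PFalse) (literals (patoms f) bs) PFalse); split.
      by rewrite -wbs; apply: (@countermodel_derives R).
    move=> w' wF' <- nf' /=; rewrite peval_foldl // /= wF' /=.
    by rewrite peval_literals //; apply: patoms_atomic.
  (* No valuation with these values falsifies [f], so any derivable formula serves as a
     placeholder. *)
  exists (PImp PFalse PFalse); split.
    by apply: TT => w /=; rewrite implybb.
  by move=> w wF wbs nf; case: nw; exists w.
pose masks := [seq val t | t : m.-tuple bool <- enum {: m.-tuple bool}].
apply: (@derivable_from ([seq PImp PFalse a | a <- patoms f] ++ map H masks)).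
  move=> h /In_cat[/List.in_map_iff [a [<- /patoms_atomic pa]]|].
    exact: (@pfalse_derives R).
  by move=> /List.in_map_iff [bs [<- _]]; apply: (HH bs).1.
move=> w; rewrite peval_foldr; apply/implyP; rewrite all_cat => /andP[Ha Hm].
(* When [PFalse] is true, the premises from [pfalse_derives] make every atom of [f] true, and hence
   [f], as implication is the only connective. *)
case wF: (w PFalse).
  apply: peval_all_atoms => a af.
  have := all_In Ha (List.in_map (PImp PFalse) _ _ af).
  by rewrite /= wF /= (peval_atomic _ (patoms_atomic af)).
apply/negPn/negP => nf; have := (HH _).2 w wF erefl nf.
have tm : size (map w (patoms f)) == m by rewrite size_map.
have mem : map w (patoms f) \in masks.
  by apply/mapP; exists (Tuple tm); rewrite ?mem_enum.
by rewrite (all_In Hm (In_map H mem)).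
Qed.
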